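(* Let $X$, $Y$ be Banach spaces and let $L$ be a locally compact Hausdorff space. If the pair $(X,Y)$ has the generalized AHSP and $\mathcal{L}(X,\mathcal{C}_0(L,Y))=\mathcal{K}(X,\mathcal{C}_0(L,Y))$, then the pair $(X, \mathcal{C}_0(L,Y))$ has the generalized AHSP. Equivalently, if the pair $(\ell_1(X),Y)$ has the BPBp and $\mathcal{L}(X,\mathcal{C}_0(L,Y))=\mathcal{K}(X,\mathcal{C}_0(L,Y))$, then the pair $(\ell_1(X), \mathcal{C}_0(L,Y))$ has the BPBp.
   Context: Banach spaces are real or complex (all over the same scalar field). For a Banach space $X$, $B_X$ is the closed unit ball, $S_X$ the unit sphere, $X^*$ the topological dual. $\mathcal{L}(X,Y)$ is the Banach space of bounded linear operators from $X$ into $Y$ with the operator norm, and $\mathcal{K}(X,Y)$ is the subspace of compact operators, i.e. those $T$ for which $\overline{T(B_X)}$ is compact in $Y$. $\ell_1(X)$ is the Banach space of all sequences $(x_k)$ in $X$ with $\sum_{k=1}^\infty \|x_k\|$ convergent, normed by this sum. $\mathcal{C}_0(L,Y)$ is the Banach space of all continuous functions from $L$ into $Y$ that vanish at infinity, with the supremum norm. A convex series $\sum_{k=1}^\infty \alpha_k$ is a series with $\alpha_k \ge 0$ and $\sum_{k=1}^\infty \alpha_k = 1$. BPBp: a pair $(X,Y)$ of Banach spaces has the Bishop-Phelps-Bollobás property for operators (BPBp) if, given $\varepsilon>0$, there is $\eta(\varepsilon)>0$ such that for every $T\in S_{\mathcal{L}(X,Y)}$ and $x_0\in S_X$ with $\|Tx_0\|>1-\eta(\varepsilon)$,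 there exist $S\in S_{\mathcal{L}(X,Y)}$ and $u_0\in S_X$ such that $\|Su_0\|=1$, $\|u_0-x_0\|<\varepsilon$ and $\|S-T\|<\varepsilon$. Generalized AHSP: a pair $(X,Y)$ of Banach spaces has the generalized approximate hyperplane series property (generalized AHSP) if, for every $\varepsilon>0$, there exists $0<\eta(\varepsilon)<\varepsilon$ such that given sequences $(T_k)\subset S_{\mathcal{L}(X,Y)}$ and $(x_k)\subset S_X$, and a convex series $\sum_{k=1}^\infty\alpha_k$ such that $\left\|\sum_{k=1}^\infty \alpha_k T_k x_k\right\|>1-\eta(\varepsilon)$, there exist a subset $A\subset\mathbb{N}$, $y^*\in S_{Y^*}$, and sequences $(S_k)\subset S_{\mathcal{L}(X,Y)}$, $(z_k)\subset S_X$ satisfying: (1) $\sum_{k\in A}\alpha_k>1-\varepsilon$; (2) $\|z_k-x_k\|<\varepsilon$ and $\|S_k-T_k\|<\varepsilon$ for all $k\in A$; (3) $y^*(S_kz_k)=1$ for every $k\in A$. *)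

(* Defs.v *)
From HB Require Import structures.
From mathcomp Require Import all_boot all_order all_algebra.
From mathcomp Require Import all_classical all_reals all_analysis.
From mathcomp Require Import complex.

Set Implicit Arguments.
Unset Strict Implicit.
Unset Printing Implicit Defensive.

Import Order.TTheory GRing.Theory Num.Theory.
Import numFieldNormedType.Exports.

Local Open Scope classical_set_scope.
Local Open Scope ring_scope.

Variant scalar_kind := real_scalars | complex_scalars.

(* The norm of a normedModType K takes its values in K. When K = R[i], x < y
   and x <= y mean that y - x is a positive, resp. nonnegative, real number;
   so 0 < e says that e is a positive real number. *)
Definition scalars (R : realType) (k : scalar_kind) : numFieldType :=
  match k with
  | real_scalars => R
  | complex_scalars => R[i]
  end.

Section scalars_theory.
Variables (R : realType) (sk : scalar_kind).
Local Notation K := (scalars R sk).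

Lemma scalars_lub (A : set K) : A !=set0 -> (forall x, A x -> 0 <= x) ->
  has_ubound A -> exists s, isLub A s.
Proof.
move: A; case: sk => /= A [a Aa] A0 [M AM].
  exists (sup A); split.
    by apply: sup_upper_bound; split; [exists a|exists M].
  by move=> b Ab; apply: ge_sup => //; exists a.
have Aim (x : R[i]) : A x -> complex.Im x = 0.
  by move=> /A0; rewrite lecE => /andP[/eqP].
have Asup : has_sup [set complex.Re x | x in A].
  split; first by exists (complex.Re a), a.
  exists (complex.Re M) => _ [x Ax <-].
  by have := AM _ Ax; rewrite lecE => /andP[].
exists (sup [set complex.Re x | x in A])%:C%C; split.
  move=> x Ax; rewrite lecE /= (Aim _ Ax) eqxx /=.
  by apply: sup_upper_bound => //; exists x.
move=> b Ab; rewrite lecE /=.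
have := Ab _ Aa; rewrite lecE (Aim _ Aa) => /andP[-> _] /=.
apply: ge_sup; first by exists (complex.Re a), a.
by move=> _ [x Ax <-]; have := Ab _ Ax; rewrite lecE => /andP[].
Qed.

Lemma supremum_isLub (A : set K) : A !=set0 -> (forall x, A x -> 0 <= x) ->
  has_ubound A -> isLub A (supremum 0 A).
Proof.
move=> A0 Age0 ubA; have [s lubs] := scalars_lub A0 Age0 ubA.
rewrite /supremum ifF; last by apply/eqP/eqP/set0P.
by case: xgetP => [y _ //|/(_ s)]; case.
Qed.

Lemma supremum_range_ge (I : Type) (g : I -> K) (M : K) :
  (forall i, 0 <= g i <= M) -> forall i, g i <= supremum 0 (range g).
Proof.
move=> gM i; have [|||ub _] := @supremum_isLub (range g).
- by exists (g i), i.
- by move=> _ [j _ <-]; have /andP[] := gM j.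
- by exists M => _ [j _ <-]; have /andP[] := gM j.
- by apply: ub; exists i.
Qed.

Lemma supremum_range_le (I : Type) (g : I -> K) (M : K) :
  (forall i, 0 <= g i <= M) -> 0 <= M -> supremum 0 (range g) <= M.
Proof.
move=> gM M0; have [g0|/set0P gn0] := eqVneq (range g) set0.
  by rewrite g0 supremum0.
have [//|||_] := @supremum_isLub (range g).
- by move=> _ [j _ <-]; have /andP[] := gM j.
- by exists M => _ [j _ <-]; have /andP[] := gM j.
- by apply=> _ [j _ <-]; have /andP[] := gM j.
Qed.

Lemma scalars_cvg_le (T : Type) (F : set_system T) (FF : ProperFilter F)
    (u : T -> K) (l e : K) : u @ F --> l -> 0 <= l ->
  (\forall t \near F, 0 <= u t <= e) -> l <= e.
Proof.
move=> /cvgrPdist_lt ul l0 ue; apply/ler_addgt0Pr => d d0.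
near F => t.
have /andP[ut0 ute] : 0 <= u t <= e by near: t.
have : `|l - u t| < d by near: t; exact: ul.
have lr : l - u t \is Num.real by rewrite rpredB ?ger0_real.
move=> /(le_lt_trans (real_ler_norm lr)) /ltW; rewrite lerBlDl => /le_trans.
by apply; rewrite lerD2r.
Unshelve. all: by end_near. Qed.

Lemma series_nneg (u : nat -> K) : (forall k, 0 <= u k) ->
  nondecreasing_seq (series u).
Proof. by move=> u0; apply: nondecreasing_series => *; exact: u0. Qed.

Lemma series_ge0 (u : nat -> K) n : (forall k, 0 <= u k) -> 0 <= series u n.
Proof. by move=> u0; rewrite /series /= sumr_ge0. Qed.

Lemma series_nneg_cvg (u : nat -> K) (M : K) : (forall k, 0 <= u k) ->
  (forall n, series u n <= M) ->
  series u @ \oo --> supremum 0 (range (series u)).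
Proof.
move=> u0 uM; set s := supremum _ _.
have [|||ub lub] := @supremum_isLub (range (series u)).
- by exists (series u 0%N), 0%N.
- by move=> _ [n _ <-]; exact: series_ge0.
- by exists M => _ [n _ <-].
have us n : series u n <= s by apply: ub; exists n.
have s0 : 0 <= s by apply: le_trans (us 0%N); exact: series_ge0.
apply/cvgrPdist_lt => e e0.
have [N sN] : exists N, s - e < series u N.
  apply: contrapT => /forallNP h.
  have : s <= s - e.
    apply: lub => _ [n _ <-]; have /negP := h n.
    by rewrite real_leNgt// ?rpredB ?ger0_real ?series_ge0// ltW.
  by rewrite lerBrDr gerDl => /(lt_le_trans e0); rewrite ltxx.
near=> n.
have Nn : series u N <= series u n.
  by apply: series_nneg => //; near: n; exact: nbhs_infty_ge.
rewrite ger0_norm ?subr_ge0// ltrBlDr -ltrBlDl.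
exact: lt_le_trans Nn.
Unshelve. all: by end_near. Qed.

Lemma series_nneg_bounded (u : nat -> K) : (forall k, 0 <= u k) ->
  cvgn (series u) -> exists M, forall n, series u n <= M.
Proof.
move=> u0 /cvg_seq_bounded /pinfty_ex_gt0[M M0 uM]; exists M => n.
by have /= := uM n I; rewrite ger0_norm// series_ge0.
Qed.

Lemma series_nneg_lim (u : nat -> K) : (forall k, 0 <= u k) ->
  cvgn (series u) -> limn (series u) = supremum 0 (range (series u)).
Proof.
move=> u0 /(series_nneg_bounded u0)[M uM].
by apply: cvg_lim; [exact: norm_hausdorff|exact: series_nneg_cvg uM].
Qed.

Lemma series_nneg_le_lim (u : nat -> K) n : (forall k, 0 <= u k) ->
  cvgn (series u) -> series u n <= limn (series u).
Proof.
move=> u0 cu; rewrite series_nneg_lim//.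
have [M uM] := series_nneg_bounded u0 cu.
by apply: (@supremum_range_ge _ _ M) => i; rewrite uM series_ge0.
Qed.

Lemma series_nneg_lim_le (u : nat -> K) (M : K) : (forall k, 0 <= u k) ->
  (forall n, series u n <= M) ->
  cvgn (series u) /\ limn (series u) <= M.
Proof.
move=> u0 uM; have cu : cvgn (series u).
  by apply/cvg_ex; eexists; exact: series_nneg_cvg uM.
split=> //; rewrite series_nneg_lim//; apply: supremum_range_le => [n|].
  by rewrite uM series_ge0.
apply: le_trans (uM 0%N); exact: series_ge0.
Qed.

End scalars_theory.

Section vanishing_functions.
Variables (R : realType) (sk : scalar_kind).
Local Notation K := (scalars R sk).
Variables (L : topologicalType) (Y : normedModType K).

Definition vanishes_at_infinity (f : L -> Y) :=
  forall e : K, 0 < e ->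
    exists2 C : set L, compact C & forall t, ~ C t -> `|f t| < e.

Definition C0_pred : {pred L -> Y} :=
  mem [set f : L -> Y | continuous f /\ vanishes_at_infinity f].

Record C0 := MkC0 { C0_fun :> L -> Y ; _ : C0_fun \in C0_pred }.

HB.instance Definition _ := [isSub for C0_fun].
HB.instance Definition _ := [Choice of C0 by <:].

Lemma C0_continuous (f : C0) : continuous f.
Proof. by case: f => f /= /set_mem[]. Qed.

Lemma C0_vanishes (f : C0) : vanishes_at_infinity f.
Proof. by case: f => f /= /set_mem[]. Qed.

Lemma C0_submod_closed : submod_closed C0_pred.
Proof.
split.
  rewrite inE; split; first by move=> x; exact: cst_continuous.
  by move=> e e0; exists set0 => [|t _]; [exact: compact0|rewrite normr0].
move=> a f g; rewrite !inE => -[fc fv] [gc gv]; split.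
  move=> x; apply: continuousD; last exact: gc.
  by apply: continuousZl_tmp; exact: fc.
move=> e e0; have a0 : 0 < `|a| + 1 by rewrite ltr_wpDl.
have e20 : 0 < e / 2 by rewrite divr_gt0.
have [C1 cC1 fC1] := fv _ (divr_gt0 e20 a0).
have [C2 cC2 gC2] := gv _ e20.
exists (C1 `|` C2); first exact: compactU.
move=> t /not_orP[/fC1 ft /gC2 gt].
rewrite (le_lt_trans (ler_normD _ _))// [ltRHS]splitr ltr_leD//; last exact: ltW.
rewrite normrZ (@le_lt_trans _ _ ((`|a| + 1) * `|f t|))//.
  by rewrite ler_wpM2r// lerDl.
by rewrite -ltr_pdivlMl// mulrC.
Qed.

HB.instance Definition _ := GRing.isSubmodClosed.Build K (L -> Y) C0_pred
  C0_submod_closed.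
HB.instance Definition _ := [SubChoice_isSubLmodule of C0 by <:].

Lemma C0_bounded (f : C0) : exists M, forall t, 0 <= `|f t| <= M.
Proof.
have [C cC fC] := C0_vanishes f (@ltr01 K).
have /compact_near_coveringP cov := cC.
have /cov : forall x, C x ->
    \forall x' \near x & M \near +oo_K, `|f x'| <= M.
  move=> x Cx; exists ([set x' | `|f x - f x'| < 1], [set M | `|f x| + 1 <= M]).
    split; last by apply: nbhs_pinfty_ge; rewrite rpredD ?normr_real ?real1.
    by have /cvgrPdist_lt := @C0_continuous f x; apply.
  move=> [x' M] /= [fx' fM]; apply: le_trans fM; rewrite -lerBlDl.
  by apply: le_trans (ltW fx'); rewrite distrC; exact: lerB_dist.
move=> /pinfty_ex_gt0[M M0 fM]; exists (M + 1) => t.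
rewrite normr_ge0 /=; have [Ct|Ct] := pselect (C t).
  by apply: le_trans (fM t Ct) _; rewrite lerDl.
by apply: le_trans (ltW (fC t Ct)) _; rewrite lerDr ltW.
Qed.

Definition C0_norm (f : C0) : K := supremum 0 (range (fun t => `|f t|)).

Lemma C0_norm_ge (f : C0) t : `|f t| <= C0_norm f.
Proof.
have [M fM] := C0_bounded f.
exact: (@supremum_range_ge _ _ _ (fun t => `|f t|) M).
Qed.

Lemma C0_norm_le (f : C0) M : 0 <= M -> (forall t, `|f t| <= M) ->
  C0_norm f <= M.
Proof.
by move=> M0 fM; apply: supremum_range_le => // t; rewrite normr_ge0 fM.
Qed.

Lemma C0_norm_ge0 (f : C0) : 0 <= C0_norm f.
Proof.
have [L0|/set0P[_ [t _ _]]] := eqVneq (range (fun t => `|f t|)) set0.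
  by rewrite /C0_norm L0 supremum0.
exact: le_trans (C0_norm_ge f t).
Qed.

Lemma C0_ext (f g : C0) : (forall t, f t = g t) -> f = g.
Proof. by move=> fg; apply/val_inj/funext. Qed.

Lemma C0_normD (f g : C0) : C0_norm (f + g) <= C0_norm f + C0_norm g.
Proof.
apply: C0_norm_le => [|t]; first by rewrite addr_ge0 ?C0_norm_ge0.
by apply: le_trans (ler_normD _ _) _; rewrite lerD ?C0_norm_ge.
Qed.

Lemma C0_normZ_le (a : K) (f : C0) : C0_norm (a *: f) <= `|a| * C0_norm f.
Proof.
apply: C0_norm_le => [|t]; first by rewrite mulr_ge0 ?C0_norm_ge0.
by rewrite normrZ ler_wpM2l ?C0_norm_ge.
Qed.

Lemma C0_normZ (a : K) (f : C0) : C0_norm (a *: f) = `|a| * C0_norm f.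
Proof.
apply/eqP; rewrite eq_le C0_normZ_le /=.
have [->|a0] := eqVneq a 0; first by rewrite normr0 mul0r C0_norm_ge0.
rewrite -ler_pdivlMl ?normr_gt0// -normfV.
by have := C0_normZ_le a^-1 (a *: f); rewrite scalerA mulVf// scale1r.
Qed.

Lemma C0_norm0_eq0 (f : C0) : C0_norm f = 0 -> f = 0.
Proof.
move=> f0; apply: C0_ext => t; apply/eqP; rewrite -normr_le0 -f0.
exact: C0_norm_ge.
Qed.

HB.instance Definition _ := Lmodule_isNormed.Build K C0
  C0_normD C0_normZ C0_norm0_eq0.

Lemma C0_normE (f : C0) : `|f| = supremum 0 (range (fun t => `|f t|)).
Proof. by []. Qed.

End vanishing_functions.

Section vanishing_functions_complete.
Variables (R : realType) (sk : scalar_kind).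
Local Notation K := (scalars R sk).
Variables (L : topologicalType) (Y : completeNormedModType K).

Lemma cauchy_near_norm (V : normedModType K) (F : set_system V)
    (FF : ProperFilter F) : cauchy F -> forall e : K, 0 < e ->
  exists2 A, F A & forall f g, A f -> A g -> `|f - g| < e.
Proof.
move=> /cauchyP Fc e e0.
have [|f0 Ff0] := Fc (e / 2); first exact: divr_gt0.
exists (ball f0 (e / 2)) => // f g; rewrite -ball_normE /= => f0f f0g.
rewrite (splitr e) -(subrKA f0) (le_lt_trans (ler_normD _ _))// ltrD//.
by rewrite distrC.
Qed.

Lemma lipschitz_cauchy (V W : normedModType K) (F : set_system V)
    (FF : ProperFilter F) (h : V -> W) :
  (forall f g, `|h f - h g| <= `|f - g|) -> cauchy F -> cauchy (h @ F).
Proof.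
move=> hlip Fc; apply/cauchyP => e e0.
have [A FA Ae] := cauchy_near_norm FF Fc e0.
have [g Ag] := filter_ex FA.
exists (h g); change (F (h @^-1` ball (h g) e)).
apply: filterS FA => f Af; rewrite /= -ball_normE /=.
exact: le_lt_trans (hlip g f) (Ae _ _ Ag Af).
Qed.

Lemma C0_complete (F : set_system (C0 L Y)) :
  ProperFilter F -> cauchy F -> cvg F.
Proof.
move=> FF Fc.
have Fcvg t : cvg ((fun f : C0 L Y => f t) @ F).
  apply: cauchy_cvg; apply: lipschitz_cauchy => // f g.
  exact: C0_norm_ge (f - g) t.
pose h t := lim ((fun f : C0 L Y => f t) @ F).
have Fh e : 0 < e -> exists2 A, F A & forall f t, A f -> `|f t - h t| <= e.
  move=> e0; have [A FA Ae] := cauchy_near_norm FF Fc e0.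
  exists A => // f t Af.
  apply: (@scalars_cvg_le _ _ _ F _ (fun g : C0 L Y => `|f t - g t|)) => //.
    apply: cvg_norm; apply: cvgB; [exact: cvg_cst|exact: Fcvg].
  apply: filterS FA => g Ag; rewrite normr_ge0 /=.
  exact: le_trans (C0_norm_ge (f - g) t) (ltW (Ae _ _ Af Ag)).
have hP : h \in @C0_pred R sk L Y.
  rewrite inE; split.
    move=> x; apply/cvgrPdist_lt => e e0.
    have e30 : 0 < e / 2 / 2 by rewrite !divr_gt0.
    have [A FA Ae] := Fh _ e30; have [f Af] := filter_ex FA.
    have /cvgrPdist_lt/(_ (e / 2)) := @C0_continuous _ _ _ _ f x.
    move=> /(_ (divr_gt0 e0 (ltr0Sn _ 1))); apply: filterS => y fxy.
    rewrite -(subrKA (f x)) (le_lt_trans (ler_normD _ _))//.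
    rewrite -(subrKA (f y) (f x)) [ltRHS]splitr.
    apply: (@le_lt_trans _ _ (e / 2 / 2 + (`|f x - f y| + e / 2 / 2))).
      rewrite lerD//; first by rewrite distrC Ae.
      by rewrite (le_trans (ler_normD _ _))// lerD2l Ae.
    by rewrite addrCA -(splitr (e / 2)) ltrD2r.
  move=> e e0; have e20 : 0 < e / 2 by rewrite divr_gt0.
  have [A FA Ae] := Fh _ e20; have [f Af] := filter_ex FA.
  have [C cC fC] := C0_vanishes f e20; exists C => // t Ct.
  rewrite -(subrK (f t) (h t)) (le_lt_trans (ler_normD _ _))//.
  by rewrite [ltRHS]splitr ler_ltD ?fC// distrC Ae.
apply/cvg_ex; exists (MkC0 hP); apply/cvgrPdist_le => e e0.
have [A FA Ae] := Fh _ e0; apply: filterS FA => f Af.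
apply: C0_norm_le => [|t]; first exact: ltW.
by rewrite distrC; exact: Ae.
Qed.

HB.instance Definition _ := Uniform_isComplete.Build (C0 L Y) C0_complete.

End vanishing_functions_complete.

Section summable_sequences.
Variables (R : realType) (sk : scalar_kind).
Local Notation K := (scalars R sk).
Variable X : normedModType K.

Definition ell1_pred : {pred nat -> X} :=
  mem [set x : nat -> X | cvgn (series (fun k => `|x k|))].

Record ell1 := MkEll1 { ell1_seq :> nat -> X ; _ : ell1_seq \in ell1_pred }.

HB.instance Definition _ := [isSub for ell1_seq].
HB.instance Definition _ := [Choice of ell1 by <:].

Lemma ell1_summable (x : ell1) : cvgn (series (fun k => `|x k|)).
Proof. by case: x => x /= /set_mem. Qed.

Lemma ell1_predP (x : nat -> X) (M : K) :
  (forall n, series (fun k => `|x k|) n <= M) -> x \in ell1_pred.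
Proof.
by move=> xM; rewrite inE; have [] := series_nneg_lim_le _ xM.
Qed.

Lemma ell1_submod_closed : submod_closed ell1_pred.
Proof.
split.
  apply: (@ell1_predP _ 0) => n.
  by rewrite /series /= big1// => i _; rewrite normr0.
move=> a x y; rewrite !inE.
move=> /(series_nneg_bounded (fun k => normr_ge0 (x k)))[M xM].
move=> /(series_nneg_bounded (fun k => normr_ge0 (y k)))[N yN].
apply: set_mem; apply: (@ell1_predP _ (`|a| * M + N)) => n.
apply: (@le_trans _ _ (`|a| * series (fun k => `|x k|) n
                       + series (fun k => `|y k|) n)).
  rewrite /series /= mulr_sumr -big_split /= ler_sum// => i _.
  by rewrite -normrZ ler_normD.
by rewrite lerD// ler_wpM2l.
Qed.

HB.instance Definition _ := GRing.isSubmodClosed.Build K (nat -> X) ell1_pred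
  ell1_submod_closed.
HB.instance Definition _ := [SubChoice_isSubLmodule of ell1 by <:].

Definition ell1_norm (x : ell1) : K := limn (series (fun k => `|x k|)).

Lemma ell1_norm_ge (x : ell1) n : series (fun k => `|x k|) n <= ell1_norm x.
Proof. by apply: series_nneg_le_lim => //; exact: ell1_summable. Qed.

Lemma ell1_norm_le (x : ell1) M :
  (forall n, series (fun k => `|x k|) n <= M) -> ell1_norm x <= M.
Proof. by move=> xM; have [] := series_nneg_lim_le _ xM. Qed.

Lemma ell1_norm_coord (x : ell1) k : `|x k| <= ell1_norm x.
Proof.
apply: le_trans (ell1_norm_ge x k.+1).
by rewrite /series /= big_nat_recr//= lerDr sumr_ge0.
Qed.

Lemma ell1_norm_ge0 (x : ell1) : 0 <= ell1_norm x.
Proof. exact: le_trans (ell1_norm_coord x 0). Qed.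

Lemma ell1_ext (x y : ell1) : (forall k, x k = y k) -> x = y.
Proof. by move=> xy; apply/val_inj/funext. Qed.

Lemma ell1_normD (x y : ell1) : ell1_norm (x + y) <= ell1_norm x + ell1_norm y.
Proof.
apply: ell1_norm_le => n.
apply: le_trans (lerD (ell1_norm_ge x n) (ell1_norm_ge y n)).
by rewrite /series /= -big_split /= ler_sum// => i _; exact: ler_normD.
Qed.

Lemma ell1_normZ_le (a : K) (x : ell1) :
  ell1_norm (a *: x) <= `|a| * ell1_norm x.
Proof.
apply: ell1_norm_le => n.
apply: le_trans (ler_wpM2l (normr_ge0 a) (ell1_norm_ge x n)).
by rewrite /series /= mulr_sumr ler_sum// => i _; rewrite -normrZ.
Qed.

Lemma ell1_normZ (a : K) (x : ell1) : ell1_norm (a *: x) = `|a| * ell1_norm x.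
Proof.
apply/eqP; rewrite eq_le ell1_normZ_le /=.
have [->|a0] := eqVneq a 0; first by rewrite normr0 mul0r ell1_norm_ge0.
rewrite -ler_pdivlMl ?normr_gt0// -normfV.
by have := ell1_normZ_le a^-1 (a *: x); rewrite scalerA mulVf// scale1r.
Qed.

Lemma ell1_norm0_eq0 (x : ell1) : ell1_norm x = 0 -> x = 0.
Proof.
move=> x0; apply: ell1_ext => k; apply/eqP; rewrite -normr_le0 -x0.
exact: ell1_norm_coord.
Qed.

HB.instance Definition _ := Lmodule_isNormed.Build K ell1
  ell1_normD ell1_normZ ell1_norm0_eq0.

Lemma ell1_normE (x : ell1) : `|x| = limn (series (fun k => `|x k|)).
Proof. by []. Qed.

End summable_sequences.

Section summable_sequences_complete.
Variables (R : realType) (sk : scalar_kind).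
Local Notation K := (scalars R sk).
Variable X : completeNormedModType K.

Lemma ell1_complete (F : set_system (ell1 X)) :
  ProperFilter F -> cauchy F -> cvg F.
Proof.
move=> FF Fc.
have Fcvg k : cvg ((fun x : ell1 X => x k) @ F).
  apply: cauchy_cvg; apply: lipschitz_cauchy => // x y.
  exact: ell1_norm_coord (x - y) k.
pose h k := lim ((fun x : ell1 X => x k) @ F).
have Fh e : 0 < e -> exists2 A, F A & forall x n, A x ->
    series (fun k => `|x k - h k|) n <= e.
  move=> e0; have [A FA Ae] := cauchy_near_norm FF Fc e0.
  exists A => // x n Ax.
  apply: (@scalars_cvg_le _ _ _ F _
      (fun y : ell1 X => series (fun k => `|x k - y k|) n)) => //.
  - rewrite /series /=; elim: n => [|n IHn].
      by under eq_cvg do rewrite big_geq//; rewrite big_geq//; exact: cvg_cst.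
    under eq_cvg do rewrite big_nat_recr//=; rewrite big_nat_recr//=.
    apply: cvgD IHn _; apply: cvg_norm; apply: cvgB; first exact: cvg_cst.
    exact: Fcvg.
  - exact: series_ge0.
  - apply: filterS FA => y Ay; rewrite series_ge0//=.
    exact: le_trans (ell1_norm_ge (x - y) n) (ltW (Ae _ _ Ax Ay)).
have hP : h \in @ell1_pred R sk X.
  have [A FA Ae] := Fh _ ltr01; have [x Ax] := filter_ex FA.
  apply: (@ell1_predP _ _ _ _ (`|x| + 1)) => n.
  apply: le_trans (lerD (ell1_norm_ge x n) (Ae x n Ax)).
  rewrite /series /= -big_split /= ler_sum// => i _.
  by rewrite -[in leLHS](subKr (x i) (h i)) ler_normB.
apply/cvg_ex; exists (MkEll1 hP); apply/cvgrPdist_le => e e0.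
have [A FA Ae] := Fh _ e0; apply: filterS FA => x Ax.
by rewrite distrC; apply: ell1_norm_le => n; exact: Ae.
Qed.

HB.instance Definition _ := Uniform_isComplete.Build (ell1 X) ell1_complete.

End summable_sequences_complete.

Unset Implicit Arguments.

Section operators.
Context {R : realType} {sk : scalar_kind}.
Local Notation K := (scalars R sk).

Definition unit_ball (X : normedModType K) : set X := [set x | `|x| <= 1].

Definition unit_sphere (X : normedModType K) : set X := [set x | `|x| = 1].

Definition bounded_operators (X Y : normedModType K) : set {linear X -> Y} :=
  [set T : {linear X -> Y} | exists M : K, forall x, `|T x| <= M * `|x|].

(* Only meaningful for bounded operators: supremum 0 A is 0 when A has no
   upper bound. *)
Definition operator_norm {X Y : normedModType K} (T : X -> Y) : K :=
  supremum 0 [set `|T x| | x in unit_ball X].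

(* The unit sphere of L(X, Y). *)
Definition unit_operators (X Y : normedModType K) : set {linear X -> Y} :=
  [set T : {linear X -> Y} | bounded_operators X Y T /\ operator_norm T = 1].

Definition compact_operators (X Y : normedModType K) : set {linear X -> Y} :=
  [set T : {linear X -> Y} | bounded_operators X Y T /\
     compact (closure [set T x | x in unit_ball X])].

(* The unit sphere of the dual of Y; K^o is K as a normed space over itself. *)
Definition unit_functionals (Y : normedModType K) : set {linear Y -> K^o} :=
  unit_operators Y K^o.

Definition BPBp (X Y : completeNormedModType K) :=
  forall e : K, 0 < e -> exists2 eta : K, 0 < eta &
    forall (T : {linear X -> Y}) (x0 : X),
      unit_operators X Y T -> unit_sphere X x0 -> `|T x0| > 1 - eta ->
      exists (S : {linear X -> Y}) (u0 : X),
        [/\ unit_operators X Y S, unit_sphere X u0, `|S u0| = 1,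
            `|u0 - x0| < e & operator_norm (S \- T) < e].

Definition convex_series (a : nat -> K) :=
  (forall k, 0 <= a k) /\ series a @ \oo --> (1 : K).

Definition generalized_AHSP (X Y : completeNormedModType K) :=
  forall e : K, 0 < e -> exists2 eta : K, 0 < eta < e &
    forall (T : nat -> {linear X -> Y}) (x : nat -> X) (a : nat -> K),
      (forall k, unit_operators X Y (T k)) ->
      (forall k, unit_sphere X (x k)) ->
      convex_series a ->
      `|limn (series (fun k => a k *: T k (x k)))| > 1 - eta ->
      exists (A : set nat) (ystar : {linear Y -> K^o})
             (S : nat -> {linear X -> Y}) (z : nat -> X),
        [/\ unit_functionals Y ystar,
            forall k, unit_operators X Y (S k) &
            forall k, unit_sphere X (z k)] /\
        [/\ limn (fun n => \sum_(0 <= k < n | k \in A) a k) > 1 - e,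
            forall k, A k ->
              `|z k - x k| < e /\ operator_norm (S k \- T k) < e &
            forall k, A k -> ystar (S k (z k)) = 1].

End operators.

(* Main.v *)
Require Import Defs.
From HB Require Import structures.
From mathcomp Require Import all_boot all_order all_algebra.
From mathcomp Require Import all_classical all_reals all_analysis.
From mathcomp Require Import complex ring.

(** The first implication is a localization. If the convex combination
    g = sum_k a_k T_k x_k in C0(L, Y) has norm larger than 1 - eta, then so has
    g(t0) for some point t0 of L, and g(t0) is a convex combination of values
    of the operators u |-> (T_k u)(t0) from X to Y. The property of (X, Y)
    supplies nearby operators S_k, points z_k and a functional y*. Compactness
    of T_k makes the functions T_k u, for u in the unit ball, equicontinuous at
    t0, so there is a bump function phi_k with values in [0, 1], equal to 1 at
    t0, off the support of which nothing has to change and on which T_k u is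
    uniformly close to its value at t0. The operator
      u |-> T_k u + phi_k (S_k u - T_k u)
    is at each point of L a convex combination of S_k u and (T_k u)(t), so it
    still has norm at most 1; it is close to T_k, and it agrees with S_k at t0.
    The functional f |-> y*(f(t0)) then does the job in C0(L, Y). This is
    [modify_near_point] and [contraction_AHSP_C0].

    The operators u |-> (T_k u)(t0) are contractions, in general not of norm 1,
    so the argument runs with contractions in place of norm-one operators.
    [AHSP_contraction] shows that this costs nothing: if a convex combination
    of the v_k = T_k x_k with norms at most 1 is almost of norm 1, then most of
    the mass sits on indices with the norm of v_k close to 1 [convex_deficit],
    and there T_k is close to T_k / |T_k|; the other indices have so little mass
    that T_k may be replaced by any norm-one operator.

    The second implication follows the same path, because an operator from
    l1(X) is the same thing as a bounded sequence of operators from X, and a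
    unit vector of l1(X) is a convex series of unit vectors. Passing from the
    Bishop-Phelps-Bollobas property to the hyperplane property usually takes a
    functional norming S u, found by Hahn-Banach. It is avoided here: that
    functional only records that the vectors S_k z_k lie in a common
    hyperplane supporting the ball, and this is also expressed by
    [aligned]: the norm is additive on the nonnegative combinations of these
    vectors. The localization is therefore proved for an arbitrary condition Q
    on the vectors S_k z_k that can be tested at a point of L, and is used
    with Q a common functional for the first implication and with Q alignment
    for the second. *)

Import Order.TTheory GRing.Theory Num.Theory.
Import numFieldNormedType.Exports.

Local Open Scope classical_set_scope.
Local Open Scope ring_scope.

Set Implicit Arguments.
Unset Strict Implicit.
Unset Printing Implicit Defensive.

(** * Series with scalars in the real or complex field *)

Section series_estimates.
Variables (R : realType) (sk : scalar_kind).
Local Notation K := (scalars R sk).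

(** The scalars may be complex, so there is no total minimum; positive scalars
    are nevertheless pairwise comparable. *)
Lemma common_lower_bound (a b c : K) : 0 < a -> 0 < b -> 0 < c ->
  exists d : K, [/\ 0 < d, d <= a, d <= b & d <= c].
Proof.
have two (x y : K) : 0 < x -> 0 < y -> exists d : K, [/\ 0 < d, d <= x & d <= y].
  move=> x0 y0; have /orP[xy|yx] := real_leVge (gtr0_real x0) (gtr0_real y0).
    by exists x.
  by exists y.
move=> a0 b0 c0; have [d [d0 da db]] := two _ _ a0 b0.
have [d' [d'0 d'd d'c]] := two _ _ d0 c0.
by exists d'; split => //; exact: le_trans d'd _.
Qed.

Lemma scalars_ler_cvg (f g : nat -> K) (l m : K) :
  f @ \oo --> l -> g @ \oo --> m -> 0 <= l -> 0 <= m ->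
  (forall n, 0 <= f n <= g n) -> l <= m.
Proof.
move=> fl gm l0 m0 fg; apply/ler_addgt0Pr => d d0.
apply: (@scalars_cvg_le _ _ _ _ _ _ _ _ fl l0); near=> n.
have /andP[f0 fgn] := fg n; have g0 := le_trans f0 fgn.
rewrite f0 /=; apply: le_trans fgn _.
have : `|m - g n| < d by near: n; move/cvgrPdist_lt: gm; apply.
rewrite distrC => gmd; rewrite -lerBlDl ltW//; apply: le_lt_trans gmd.
by apply: real_ler_norm; apply: rpredB; exact: ger0_real.
Unshelve. all: by end_near. Qed.

(** The bounded increasing partial sums of the norms converge, so they are
    Cauchy, and they dominate the partial sums of u. *)
Lemma absolutely_cvg (V : completeNormedModType K) (u : nat -> V) (M : K) :
  (forall n, series (fun k => `|u k|) n <= M) -> cvgn (series u).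
Proof.
move=> uM; have [cu _] := series_nneg_lim_le (fun k => normr_ge0 (u k)) uM.
move: cu => /cvg_cauchy/cauchy_seriesP cu.
apply/cauchy_cvgP/cauchy_seriesP => e /cu.
apply: filterS => n /=; rewrite ger0_norm ?sumr_ge0//.
by apply: le_lt_trans; apply: ler_norm_sum.
Qed.

Lemma norm_series_le (V : normedModType K) (u : nat -> V) (l : V) (M : K) :
  series u @ \oo --> l ->
  (forall n, series (fun k => `|u k|) n <= M) -> `|l| <= M.
Proof.
move=> ul uM; apply: (@scalars_cvg_le _ _ _ _ _ _ _ _ (cvg_norm ul)) => //.
near=> n; rewrite normr_ge0 /=; apply: le_trans (uM n).
exact: ler_norm_sum.
Unshelve. all: by end_near. Qed.

Lemma convex_partial_le1 (a : nat -> K) n : convex_series a -> series a n <= 1.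
Proof.
move=> [a0 a1]; rewrite -(cvg_lim (@norm_hausdorff _ _) a1).
by apply: series_nneg_le_lim => //; apply/cvg_ex; exists 1.
Qed.

Lemma convex_le (a : nat -> K) (M : K) :
  convex_series a -> (forall n, series a n <= M) -> 1 <= M.
Proof.
move=> [a0 a1] aM; rewrite -(cvg_lim (@norm_hausdorff _ _) a1).
by have [] := series_nneg_lim_le a0 aM.
Qed.

Lemma convex_combination_cvg (V : completeNormedModType K) (a : nat -> K)
    (v : nat -> V) : convex_series a -> (forall k, `|v k| <= 1) ->
  series (fun k => a k *: v k) @ \oo -->
  limn (series (fun k => a k *: v k)).
Proof.
move=> ca v1; have a0 := ca.1; apply: (@absolutely_cvg _ _ 1) => n.
apply: le_trans (convex_partial_le1 n ca); apply: ler_sum => k _.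
by rewrite normrZ ger0_norm// ler_piMr.
Qed.

(** The norm of the sum is at most the sum of the a_k |v_k|, which is
    1 minus the sum of the deficits a_k (1 - |v_k|). Bounding partial sums keeps
    limits out of the statement. *)
Lemma convex_deficit (V : completeNormedModType K) (a : nat -> K)
    (v : nat -> V) (eta : K) :
  convex_series a -> (forall k, `|v k| <= 1) ->
  1 - eta < `|limn (series (fun k => a k *: v k))| ->
  forall n, series (fun k => a k * (1 - `|v k|)) n <= eta.
Proof.
move=> ca v1 big n; have a0 := ca.1.
have d0 k : 0 <= a k * (1 - `|v k|) by rewrite mulr_ge0 ?subr_ge0.
suff : 1 - eta < 1 - series (fun k => a k * (1 - `|v k|)) n.
  by rewrite ltrD2l ltrN2 => /ltW.
apply: lt_le_trans big _; apply: norm_series_le (convex_combination_cvg ca v1) _.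
move=> m; set u := (fun k => `|_|).
have uE k : u k = a k * `|v k| by rewrite /u normrZ ger0_norm.
have mN : series u m <= series u (maxn m n).
  by apply: series_nneg => [k|]; [exact: normr_ge0|exact: leq_maxl].
apply: le_trans mN _; rewrite lerBrDr.
have nN := series_nneg d0 (leq_maxr m n).
apply: le_trans (convex_partial_le1 (maxn m n) ca).
apply: le_trans (lerD (lexx _) nN) _; rewrite /series /= -big_split /=.
by apply: ler_sum => k _; rewrite uE -mulrDr addrC subrK mulr1.
Qed.

(** A large mass inside A is expressed by small partial masses outside A, which
    needs no limit and behaves well under intersection of index sets. *)
Definition mass_outside (A : set nat) (a : nat -> K) n :=
  \sum_(0 <= k < n | k \notin A) a k.

Lemma sub_mass_outside (A B : set nat) (a : nat -> K) n : (forall k, 0 <= a k) ->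
  mass_outside (A `&` B) a n <= mass_outside A a n + mass_outside B a n.
Proof.
move=> a0; rewrite /mass_outside [leLHS]big_mkcond [X in X + _]big_mkcond.
rewrite [X in _ + X]big_mkcond -big_split /=; apply: ler_sum => k _.
rewrite in_setI negb_and.
by case: (k \in A); case: (k \in B) => /=; rewrite ?addr0 ?add0r ?lerDl.
Qed.

Lemma partial_massD (A : set nat) (a : nat -> K) n :
  \sum_(0 <= k < n | k \in A) a k + mass_outside A a n = series a n.
Proof. by rewrite /series /= [RHS](bigID (fun k => k \in A)). Qed.

Lemma lim_massE (A : set nat) (a : nat -> K) :
  (fun n => \sum_(0 <= k < n | k \in A) a k) =
  series (fun k => if k \in A then a k else 0).
Proof. by apply/funext => n; rewrite big_mkcond. Qed.

Lemma mass_inside_ge (A : set nat) (a : nat -> K) (b : K) :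
  convex_series a -> (forall n, mass_outside A a n <= b) ->
  1 - b <= limn (fun n => \sum_(0 <= k < n | k \in A) a k).
Proof.
move=> ca outA; have a0 := ca.1; rewrite lerBlDr; apply: (convex_le ca) => n.
have aA0 k : 0 <= (if k \in A then a k else 0) by case: ifP.
rewrite -(partial_massD A) lerD// lim_massE.
have -> : \sum_(0 <= k < n | k \in A) a k =
    series (fun k => if k \in A then a k else 0) n by rewrite -lim_massE.
apply: series_nneg_le_lim => //; apply: (proj1 (series_nneg_lim_le aA0 (M := 1) _)).
move=> m; rewrite -lim_massE; apply: le_trans (convex_partial_le1 m ca).
by rewrite -(partial_massD A) lerDl sumr_ge0.
Qed.

Lemma mass_outside_le (A : set nat) (a : nat -> K) (b : K) :
  convex_series a ->
  1 - b < limn (fun n => \sum_(0 <= k < n | k \in A) a k) ->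
  forall n, mass_outside A a n <= b.
Proof.
move=> ca inA n; have a0 := ca.1.
have aA0 k : 0 <= (if k \in A then a k else 0) by case: ifP.
suff : 1 - b < 1 - mass_outside A a n by rewrite ltrD2l ltrN2 => /ltW.
apply: lt_le_trans inA _; rewrite lim_massE.
apply: (proj2 (series_nneg_lim_le aA0 _)) => m.
apply: le_trans (series_nneg aA0 (leq_maxl m n)) _; rewrite lerBrDr.
apply: le_trans (convex_partial_le1 (maxn m n) ca).
rewrite -(partial_massD A a) -lim_massE lerD2l /mass_outside.
rewrite [leRHS](@big_cat_nat _ _ _ n _ (maxn m n)) ?leq_maxr//=.
by rewrite lerDl sumr_ge0.
Qed.

Lemma massive_nonempty (A : set nat) (a : nat -> K) (b : K) :
  convex_series a -> b < 1 -> (forall n, mass_outside A a n <= b) -> A !=set0.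
Proof.
move=> ca b1 outA; apply/set0P; apply/eqP => A0.
suff : 1 <= b by move=> /(lt_le_trans b1); rewrite ltxx.
apply: (convex_le ca) => n; apply: le_trans (outA n).
rewrite -(partial_massD A) [X in X + _]big1 ?add0r// => k.
by rewrite A0 in_set0.
Qed.

End series_estimates.

(** * Operator norms and contractions *)

Section operators_basics.
Variables (R : realType) (sk : scalar_kind).
Local Notation K := (scalars R sk).
Implicit Types X Y : normedModType K.

Definition contraction X Y (T : X -> Y) := forall x, `|T x| <= `|x|.

Lemma operator_norm_isLub X Y (T : {linear X -> Y}) : bounded_operators X Y T ->
  isLub [set `|T x| | x in unit_ball X] (operator_norm T).
Proof.
move=> [M TM]; apply: supremum_isLub.
- by exists `|T 0|, 0 => //; rewrite /unit_ball /= normr0.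
- by move=> _ [x _ <-].
- exists `|M| => _ [x x1 <-]; apply: le_trans (TM x) _.
  have [->|x0] := eqVneq `|x| 0; first by rewrite mulr0.
  have xp : 0 < `|x| by rewrite lt_def x0 /=.
  have Mr : M \is Num.real.
    have : 0 <= M * `|x| by apply: le_trans (TM x).
    by rewrite pmulr_lge0// => /ger0_real.
  by apply: le_trans (ler_wpM2r _ (real_ler_norm Mr)) _ => //; rewrite ler_piMr.
Qed.

Lemma operator_norm_ge0 X Y (T : {linear X -> Y}) : bounded_operators X Y T ->
  0 <= operator_norm T.
Proof.
move=> bT; apply: (@le_trans _ _ `|T 0|) => //.
by apply: (operator_norm_isLub bT).1; exists 0 => //; rewrite /unit_ball /= normr0.
Qed.

Lemma operator_norm_ge X Y (T : {linear X -> Y}) x : bounded_operators X Y T ->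
  `|T x| <= operator_norm T * `|x|.
Proof.
move=> bT; have [->|x0] := eqVneq x 0; first by rewrite linear0 !normr0 mulr0.
have xp : 0 < `|x| by rewrite normr_gt0.
rewrite -ler_pdivrMr// mulrC -[`|x|^-1]ger0_norm ?invr_ge0// -normrZ -linearZ.
apply: (operator_norm_isLub bT).1; exists (`|x|^-1 *: x) => //.
by rewrite /unit_ball /= normrZ normfV normr_id mulVf// gt_eqF.
Qed.

Lemma operator_norm_le X Y (T : {linear X -> Y}) (M : K) : 0 <= M ->
  (forall x, `|T x| <= M * `|x|) -> operator_norm T <= M.
Proof.
move=> M0 TM; apply: (operator_norm_isLub _).2; first by exists M.
move=> _ [x x1 <-]; apply: le_trans (TM x) _.
by rewrite ler_piMr.
Qed.

Lemma contraction_bounded X Y (T : {linear X -> Y}) :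
  contraction T -> bounded_operators X Y T.
Proof. by move=> cT; exists 1 => x; rewrite mul1r. Qed.

Lemma unit_operator_contraction X Y (T : {linear X -> Y}) :
  unit_operators X Y T -> contraction T.
Proof. by move=> [bT T1] x; rewrite -[leRHS]mul1r -T1; exact: operator_norm_ge. Qed.

Lemma contraction_unit_operator X Y (T : {linear X -> Y}) x :
  contraction T -> `|x| = 1 -> 1 <= `|T x| -> unit_operators X Y T.
Proof.
move=> cT x1 Tx1; have bT := contraction_bounded cT; split=> //.
apply/eqP; rewrite eq_le; apply/andP; split.
  by apply: operator_norm_le => // y; rewrite mul1r.
by apply: le_trans Tx1 _; have := operator_norm_ge x bT; rewrite x1 mulr1.
Qed.

Lemma normalized_operator X Y (T : {linear X -> Y}) :
  bounded_operators X Y T -> 0 < operator_norm T ->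
  exists2 T' : {linear X -> Y}, unit_operators X Y T' &
    forall x, T' x = (operator_norm T)^-1 *: T x.
Proof.
move=> bT N0; set N := operator_norm T in N0 *.
exists ((N^-1 \*: T)%R : {linear X -> Y}) => //.
have cT' : contraction (N^-1 \*: T)%R.
  move=> x; rewrite /= normrZ [`|N^-1|]ger0_norm ?invr_ge0 ?(ltW N0)// ler_pdivrMl//.
  exact: operator_norm_ge.
have bT' := contraction_bounded cT'; split=> //.
apply/eqP; rewrite eq_le; apply/andP; split.
  by apply: operator_norm_le => // y; rewrite mul1r; exact: cT'.
suff : N <= N * operator_norm (N^-1 \*: T)%R by rewrite ler_pMr.
apply: operator_norm_le => [|x]; first by rewrite mulr_ge0 ?operator_norm_ge0 ?ltW.
have /= := operator_norm_ge x bT'; rewrite normrZ [`|N^-1|]ger0_norm ?invr_ge0 ?(ltW N0)//.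
by rewrite ler_pdivrMl// mulrA.
Qed.

(** The operator is T / |T|, at distance 1 - |T| < d from T since T almost
    attains 1 at x; dividing by |T| <= 1 can only increase the values. *)
Lemma nearby_unit_operator X Y (T : {linear X -> Y}) x (d : K) :
  contraction T -> `|x| = 1 -> d <= 1 -> 1 - d < `|T x| ->
  exists T' : {linear X -> Y}, [/\ unit_operators X Y T',
    forall u, `|T' u - T u| <= d * `|u| & forall u, `|T u| <= `|T' u|].
Proof.
move=> cT x1 d1 dTx; have bT := contraction_bounded cT.
set N := operator_norm T.
have Nd : 1 - d < N.
  apply: lt_le_trans dTx _.
  by have := operator_norm_ge x bT; rewrite x1 mulr1.
have N0 : 0 < N by apply: le_lt_trans Nd; rewrite subr_ge0.
have N1 : N <= 1 by apply: operator_norm_le => // u; rewrite mul1r; exact: cT.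
have [T' uT' T'E] := normalized_operator bT N0.
have TE u : T u = N *: T' u by rewrite T'E scalerA divff ?gt_eqF// scale1r.
exists T'; split=> // u; last first.
  by rewrite TE normrZ (gtr0_norm N0) ler_piMl.
rewrite TE -[X in X - _]scale1r -scalerBl normrZ ger0_norm ?subr_ge0//.
apply: ler_pM => //; first by rewrite subr_ge0.
  by rewrite lerBlDr -lerBlDl ltW.
exact: (unit_operator_contraction uT').
Qed.

End operators_basics.

(** * The hyperplane series property for contractions *)

Section approximation_property.
Variables (R : realType) (sk : scalar_kind).
Local Notation K := (scalars R sk).

(** Contractions, unlike norm-one operators, are preserved by evaluation at a
    point and by restriction to a summand. The requirement that the vectors S_k z_k lie in a common
    supporting hyperplane is left as a parameter Q. *)
Definition contraction_AHSP (X Y : completeNormedModType K)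
    (Q : set nat -> (nat -> Y) -> Prop) :=
  forall e : K, 0 < e -> exists2 eta : K, 0 < eta &
    forall (T : nat -> {linear X -> Y}) (x : nat -> X) (a : nat -> K),
      (forall k, contraction (T k)) -> (forall k, `|x k| = 1) ->
      convex_series a ->
      1 - eta < `|limn (series (fun k => a k *: T k (x k)))| ->
      exists (A : set nat) (S : nat -> {linear X -> Y}) (z : nat -> X),
        [/\ forall n, mass_outside A a n <= e,
            forall k, A k -> [/\ contraction (S k), `|z k| = 1,
              `|z k - x k| <= e & forall u, `|S k u - T k u| <= e * `|u|] &
            Q A (fun k => S k (z k))].

Definition common_functional (Y : completeNormedModType K) (A : set nat)
    (v : nat -> Y) :=
  exists2 ystar : {linear Y -> K^o}, unit_functionals Y ystar &
    forall k, A k -> ystar (v k) = 1.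

(** Where T_k x_k has norm above 1 - d, T_k is within d of a norm-one operator.
    By [convex_deficit] the remaining indices have mass at most d, so changing
    T_k there to an arbitrary norm-one operator moves the sum by at most 2d;
    altogether the sum moves by at most 3d. *)
Lemma AHSP_contraction (X Y : completeNormedModType K) :
  generalized_AHSP X Y -> contraction_AHSP X (@common_functional Y).
Proof.
move=> hXY e e0.
have [e1 [e10 e1e e11 _]] := common_lower_bound (divr_gt0 e0 (ltr0Sn K 1))
  (@ltr01 K) (@ltr01 K).
have [eta0 /andP[eta00 eta0e1] {}hXY] := hXY _ e10.
pose d : K := eta0 / 4%:R.
have d0 : 0 < d by rewrite divr_gt0 ?ltr0n.
have d4 : d *+ 4 = eta0 by rewrite -mulr_natr /d divfK ?pnatr_eq0.
have de1 : d <= e1.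
  by apply: le_trans (ltW eta0e1); rewrite -d4 mulrSr lerDr mulrn_wge0// ltW.
have d1 : d < 1.
  apply: lt_le_trans e11; apply: le_lt_trans eta0e1.
  by rewrite -d4 mulrSr lerDr mulrn_wge0// ltW.
(* The deficit bound d * d gives mass at most d to the indices of deficit at
   least d, and 1 - d * d - 3 * d >= 1 - 4 * d = 1 - eta0. *)
exists (d * d); first exact: mulr_gt0.
move=> T x a cT x1 ca big.
pose v k := T k (x k); have a0 := ca.1.
have v1 k : `|v k| <= 1 by rewrite -(x1 k); exact: cT.
have deficit := convex_deficit ca v1 big.
pose B : set nat := [set k | 1 - d < `|v k|].
have notB k : k \notin B -> d <= 1 - `|v k|.
  move=> /negP; rewrite inE /B /= => /negP nB.
  by rewrite lerBrDr addrC -lerBrDr real_leNgt ?rpredB ?real1 ?normr_real ?gtr0_real.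
have massB n : mass_outside B a n <= d.
  rewrite -(ler_pM2r d0) mulr_suml; apply: le_trans (deficit n).
  rewrite big_mkcond; apply: ler_sum => k _; case: ifP => [/notB ?|_].
    by rewrite ler_wpM2l.
  by rewrite mulr_ge0 ?subr_ge0.
have normalB k : B k -> exists2 T' : {linear X -> Y}, unit_operators X Y T' &
    forall u, `|T' u - T k u| <= d * `|u|.
  by move=> /(nearby_unit_operator (cT k) (x1 k) (ltW d1))[T' []]; exists T'.
have [k0 /normalB[T0 uT0 _]] := massive_nonempty ca d1 massB.
(* T0 serves as a filler off B. *)
have /choice[T' T'P] : forall k, exists T' : {linear X -> Y},
    unit_operators X Y T' /\ (B k -> forall u, `|T' u - T k u| <= d * `|u|).
  move=> k; have [/normalB[T' uT' T'T]|nBk] := pselect (B k); first by exists T'.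
  by exists T0; split.
have v'1 k : `|T' k (x k)| <= 1.
  by rewrite -(x1 k); exact: (unit_operator_contraction (T'P k).1).
have big' : 1 - eta0 < `|limn (series (fun k => a k *: T' k (x k)))|.
  have cv := convex_combination_cvg ca v1.
  have cv' := convex_combination_cvg ca v'1.
  set l := limn _ in cv; set l' := limn _ in cv' *.
  have ll' : `|l - l'| <= d *+ 3.
    have : series (fun k => a k *: v k - a k *: T' k (x k)) @ \oo --> l - l'.
      rewrite [X in X @ _](_ : _ = series (fun k => a k *: v k)
          - series (fun k => a k *: T' k (x k))); first exact: cvgB.
      by apply/funext => n; rewrite /series /= sumrB.
    move=> /norm_series_le; apply=> n.
    apply: (@le_trans _ _ (series a n * d + mass_outside B a n *+ 2)).
      rewrite /series /= mulr_suml /mass_outside [X in X *+ 2]big_mkcond.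
      rewrite -sumrMnl -big_split /=.
      apply: ler_sum => k _; rewrite -scalerBr normrZ ger0_norm//.
      case: ifPn => [_|].
        rewrite -mulr_natr -mulrDr ler_wpM2l//.
        apply: le_trans (ler_normB _ _) _.
        by apply: le_trans (lerD (v1 k) (v'1 k)) _; rewrite lerDr ltW.
      rewrite negbK inE mul0rn addr0 => /(T'P k).2 T'T.
      by rewrite ler_wpM2l// distrC; have := T'T (x k); rewrite x1 mulr1.
    rewrite (mulrSr _ 2) addrC; apply: lerD; first by rewrite lerMn2r massB orbT.
    by rewrite ler_piMl ?convex_partial_le1// ltW.
  rewrite -(ltrD2r (d *+ 3)); apply: (@lt_le_trans _ _ `|l|).
    apply: le_lt_trans big.
    have -> : 1 - eta0 + d *+ 3 = 1 - d by rewrite -d4; ring.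
    by rewrite lerD2l lerN2 ler_piMr// ltW.
  rewrite -[X in `|X| <= _](subrK l').
  by apply: le_trans (ler_normD _ _) _; rewrite addrC lerD2l.
have [A [ystar [S [z [[uy uS uz] [massA close yS]]]]]] :=
  hXY T' x a (fun k => (T'P k).1) x1 ca big'.
have e1d : e1 + d <= e by rewrite [leRHS]splitr lerD// (le_trans de1).
exists (A `&` B), S, z; split=> [n|k [Ak Bk]|].
- apply: le_trans (sub_mass_outside _ _ _ a0) _; apply: le_trans e1d.
  by rewrite lerD//; exact: mass_outside_le.
- have [zx ST] := close k Ak; split=> //.
  + exact: (unit_operator_contraction (uS k)).
  + exact: uz.
  + by apply: le_trans (ltW zx) _; apply: le_trans e1d; rewrite lerDl ltW.
  + move=> u; rewrite -[S k u](subrK (T' k u)) -addrA.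
    apply: le_trans (ler_normD _ _) _.
    apply: (@le_trans _ _ ((e1 + d) * `|u|)); last by rewrite ler_wpM2r.
    rewrite mulrDl lerD ?(T'P k).2//.
    have bST : bounded_operators X Y (S k \- T' k).
      exists 2 => w; apply: le_trans (ler_normB _ _) _.
      rewrite mulr_natl mulr2n lerD//.
        exact: (unit_operator_contraction (uS k)).
      exact: (unit_operator_contraction (T'P k).1).
    apply: le_trans (operator_norm_ge u bST) _.
    by rewrite ler_wpM2r// ltW.
- by exists ystar => // k [Ak _]; exact: yS.
Qed.

(** For k in A the operator S_k has norm 1, because ystar has norm 1 and takes
    the value 1 at S_k z_k; outside A one keeps T_k and x_k. *)
Lemma contraction_AHSP_generalized (X Z : completeNormedModType K) :
  contraction_AHSP X (@common_functional Z) -> generalized_AHSP X Z.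
Proof.
move=> hXZ e e0; have e20 : 0 < e / 2 by rewrite divr_gt0.
have e2e : e / 2 < e by rewrite [ltRHS]splitr ltrDl.
have [eta eta0 {}hXZ] := hXZ _ e20.
have [eta1 [eta10 eta1eta eta1e _]] := common_lower_bound eta0 e20 e20.
exists eta1; first by rewrite eta10 (le_lt_trans eta1e).
move=> T x a uT ux ca big.
have cT k := unit_operator_contraction (uT k).
have {}big : 1 - eta < `|limn (series (fun k => a k *: T k (x k)))|.
  by apply: le_lt_trans big; rewrite lerD2l lerN2.
have [A [S [z [massA SzA [ystar uy yS]]]]] := hXZ T x a cT ux ca big.
exists A, ystar, (fun k => if k \in A then S k else T k),
  (fun k => if k \in A then z k else x k).
split; split=> //.
- move=> k; case: ifPn => //; rewrite inE => Ak.
  have [cS z1 _ _] := SzA k Ak.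
  apply: (contraction_unit_operator cS z1).
  apply: le_trans (unit_operator_contraction uy (S k (z k))).
  by rewrite yS// normr1.
- by move=> k; case: ifPn => //; rewrite inE => /SzA[].
- by apply: lt_le_trans (mass_inside_ge ca massA); rewrite ltrD2l ltrN2.
- move=> k Ak; have /mem_set -> := Ak; have [cS z1 zx ST] := SzA k Ak.
  split; first exact: le_lt_trans e2e.
  by apply: le_lt_trans e2e; apply: operator_norm_le => //; exact: ltW.
- by move=> k Ak; have /mem_set -> := Ak; exact: yS.
Qed.

End approximation_property.

(** * Continuity of contractions *)

Section contraction_limits.
Variables (R : realType) (sk : scalar_kind).
Local Notation K := (scalars R sk).

Lemma contraction_cvg (V W : normedModType K) (T : {linear V -> W})
    (u : nat -> V) (l : V) : contraction T -> u @ \oo --> l ->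
  (fun n => T (u n)) @ \oo --> T l.
Proof.
move=> cT /cvgrPdist_lt ul; apply/cvgrPdist_lt => e /ul; apply: filterS => n.
by apply: le_lt_trans; rewrite -linearB; exact: cT.
Qed.

Lemma contraction_series_cvg (V W : normedModType K) (T : {linear V -> W})
    (u : nat -> V) (l : V) : contraction T -> series u @ \oo --> l ->
  series (fun k => T (u k)) @ \oo --> T l.
Proof.
move=> cT /(contraction_cvg cT).
rewrite [X in X @ _ --> _](_ : _ = series (fun k => T (u k)))//.
by apply/funext => n; rewrite /series /= linear_sum.
Qed.

End contraction_limits.

(** * Bump functions on a locally compact Hausdorff space *)

Section bump_functions.
Variables (R : realType) (sk : scalar_kind).
Local Notation K := (scalars R sk).

Lemma real_embedding : exists h : R -> K,
  [/\ continuous h, h 0 = 0, h 1 = 1 & forall x, 0 <= x <= 1 -> 0 <= h x <= 1].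
Proof.
case: sk => /=; first by exists id; split => // x; exact: cvg_id.
exists (fun x => x%:C%C); split => // [x|x]; last by rewrite !lecR.
apply/cvgrPdist_lt => e e0.
have eE : e = (complex.Re e)%:C%C.
  by case: e e0 => c b; rewrite ltcE /= => /andP[/eqP-> _].
have e0' : 0 < complex.Re e by rewrite -ltcR -eE.
have /cvgrPdist_lt/(_ _ e0') := @cvg_id _ (nbhs x); apply: filterS => y xy.
have -> : x%:C%C - y%:C%C = (x - y)%:C%C by rewrite rmorphB.
by rewrite normc_def /= expr0n addr0 sqrtr_sqr eE ltcR.
Qed.

(** A locally compact Hausdorff space is completely regular; the function
    separates t0 from the complement of the interior of U intersected with a
    compact neighbourhood of t0, which also confines its support. *)
Lemma bump_function (L : topologicalType) (t0 : L) (U : set L) :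
  hausdorff_space L -> locally_compact [set: L] -> nbhs t0 U ->
  exists phi : L -> K, [/\ continuous phi, forall t, 0 <= phi t <= 1,
    phi t0 = 1, forall t, ~ U t -> phi t = 0 &
    exists2 C : set L, compact C & forall t, ~ C t -> phi t = 0].
Proof.
move=> hL lcL Ut0.
have [C] := lcL t0 I; rewrite withinET => Ct0 [cC _].
pose B := ~` (U `&` C)°.
have cB : closed B by apply: open_closedC; exact: open_interior.
have nB : ~ B t0 by apply; exact: filterI.
have := @locally_compact_completely_regular L R lcL hL t0 B cB nB.
move=> /(@uniform_separatorP _ R)[f [cf f01 f0 f1]].
have [h [ch h0 h1 h01]] := real_embedding.
have fB t : B t -> h (1 - f t) = 0.
  by move=> Bt; rewrite (_ : f t = 1) ?subrr//; apply: f1; exists t.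
exists (fun t => h (1 - f t)); split.
- move=> t; apply: continuous_comp; last exact: ch.
  by apply: continuousB; [exact: cst_continuous|exact: cf].
- move=> t; apply: h01; have : `[0, 1]%classic (f t) by apply: f01; exists t.
  by rewrite /= in_itv /= subr_ge0 gerBl => /andP[-> ->].
- by rewrite (_ : f t0 = 0) ?subr0//; apply: f0; exists t0.
- by move=> t Ut; apply: fB => /interior_subset[].
- by exists C => // t Ct; apply: fB => /interior_subset[].
Qed.

End bump_functions.

(** * Localization at a point of the base space *)

Section localization.
Variables (R : realType) (sk : scalar_kind).
Local Notation K := (scalars R sk).
Variables (L : topologicalType) (X Y : completeNormedModType K).

Definition C0_eval (t : L) (f : C0 L Y) : Y := f t.

Lemma C0_eval_linear t : linear (C0_eval t).
Proof. by []. Qed.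

HB.instance Definition _ t :=
  GRing.isLinear.Build K (C0 L Y) Y *:%R (C0_eval t) (C0_eval_linear t).

Lemma C0_eval_contraction t : contraction (C0_eval t).
Proof. by move=> f; exact: C0_norm_ge. Qed.

(** The easy half of the Arzela-Ascoli theorem, by the usual e / 3 argument. *)
Lemma compact_C0_equicontinuous (F : set (C0 L Y)) (t0 : L) (e : K) :
  compact F -> 0 < e ->
  \forall t \near t0, forall f, F f -> `|f t - f t0| <= e.
Proof.
move=> /compact_near_coveringP cF e0.
apply: (cF L (nbhs t0) (fun t f => `|f t - f t0| <= e)) => f Ff.
have e30 : 0 < e / 3%:R by rewrite divr_gt0 ?ltr0n.
exists ([set f' | `|f - f'| < e / 3%:R], [set t | `|f t0 - f t| < e / 3%:R]).
  split; first by have /cvgrPdist_lt := @cvg_id _ (nbhs f); apply.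
  by have /cvgrPdist_lt := @C0_continuous _ _ _ _ f t0; apply.
move=> [f' t] /= [ff' ft].
have close s : `|f s - f' s| <= e / 3%:R.
  by apply: le_trans (ltW ff'); exact: (C0_norm_ge (f - f')).
have -> : f' t - f' t0 = (f' t - f t) + (f t - f t0) + (f t0 - f' t0).
  by rewrite !subrKA.
have -> : e = e / 3%:R + e / 3%:R + e / 3%:R.
  by field.
do 2 (apply: le_trans (ler_normD _ _) _; apply: lerD => //).
  by rewrite distrC.
by rewrite distrC ltW.
Qed.

Lemma C0_blend (phi : L -> K) (y : Y) (f : C0 L Y) : continuous phi ->
  (exists2 C : set L, compact C & forall t, ~ C t -> phi t = 0) ->
  (fun t => f t + phi t *: (y - f t)) \in @C0_pred R sk L Y.
Proof.
move=> cphi [C cC phiC]; rewrite inE; split.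
  move=> t; apply: continuousD; first exact: C0_continuous.
  apply: continuousZ; first exact: cphi.
  apply: continuousB; [exact: cst_continuous|exact: C0_continuous].
move=> e e0; have [C' cC' fC'] := C0_vanishes f e0.
exists (C `|` C'); first exact: compactU.
by move=> t /not_orP[/phiC -> /fC']; rewrite scale0r addr0.
Qed.

(** The modified operator is u |-> T u + phi (S u - T u), with phi a bump
    function supported where all T u, for u in the unit ball, are within d of their value
    at t0. Pointwise it is a convex combination of T u and S u, hence a
    contraction. *)
Lemma modify_near_point (T : {linear X -> C0 L Y}) (S : {linear X -> Y})
    (t0 : L) (e d : K) :
  hausdorff_space L -> locally_compact [set: L] ->
  compact_operators X (C0 L Y) T -> contraction T -> contraction S -> 0 < d ->
  (forall u, `|S u - T u t0| <= e * `|u|) ->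
  exists S' : {linear X -> C0 L Y},
    [/\ contraction S', forall u, `|S' u - T u| <= (e + d) * `|u| &
        forall u, S' u t0 = S u].
Proof.
move=> hL lcL [_ cptT] cT cS d0 ST.
have [phi [cphi phi01 phit0 phiU phiC]] :=
  bump_function R sk hL lcL (compact_C0_equicontinuous t0 cptT d0).
pose F u : C0 L Y := MkC0 (C0_blend (S u) (T u) cphi phiC).
have FE u t : F u t = T u t + phi t *: (S u - T u t) by [].
have linF : linear F.
  move=> a u w; apply: C0_ext => t.
  change (F (a *: u + w) t = a *: F u t + F w t).
  have TE : T (a *: u + w) t = a *: T u t + T w t by rewrite linearP.
  rewrite !FE TE linearP opprD [in LHS]addrACA -scalerBr.
  set D := S u - T u t; set E := S w - T w t.
  by rewrite !scalerDr !scalerA (mulrC a) addrACA.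
pose F' : {linear X -> C0 L Y} :=
  HB.pack F (GRing.isLinear.Build K X (C0 L Y) *:%R F linF).
exists F'; split.
- move=> u; apply: C0_norm_le => // t; change (`|F u t| <= `|u|).
  have /andP[p0 p1] := phi01 t.
  have -> : F u t = (1 - phi t) *: T u t + phi t *: S u.
    by rewrite FE scalerBr scalerBl scale1r addrA addrAC.
  apply: le_trans (ler_normD _ _) _.
  have -> : `|u| = (1 - phi t) * `|u| + phi t * `|u|.
    by rewrite -mulrDl subrK mul1r.
  have p1' : 0 <= 1 - phi t by rewrite subr_ge0.
  rewrite !normrZ (ger0_norm p0) (ger0_norm p1').
  apply: lerD; last by apply: ler_wpM2l => //; exact: cS.
  by apply: ler_wpM2l => //; exact: le_trans (C0_norm_ge (T u) t) (cT u).
- move=> u; have ed0 : 0 <= (e + d) * `|u|.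
    rewrite mulrDl addr_ge0//; first exact: le_trans (ST u).
    by rewrite mulr_ge0 ?(ltW d0).
  apply: C0_norm_le => // t; change (`|F u t - T u t| <= (e + d) * `|u|).
  rewrite FE addrC addKr normrZ; have /andP[p0 p1] := phi01 t.
  rewrite ger0_norm//.
  have [Ut|/phiU ->] := pselect (forall f : C0 L Y,
      closure [set T x | x in unit_ball X] f -> `|f t - f t0| <= d); last first.
    by rewrite mul0r.
  apply: (@le_trans _ _ `|S u - T u t|); first by rewrite ler_piMl.
  rewrite -(subrKA (T u t0)); apply: le_trans (ler_normD _ _) _.
  rewrite mulrDl; apply: lerD; first exact: ST.
  rewrite distrC.
  have [->|u0] := eqVneq u 0.
    by rewrite linear0 subrr !normr0 mulr0.
  have up : 0 < `|u| by rewrite normr_gt0.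
  rewrite -ler_pdivrMr// mulrC -[`|u|^-1]ger0_norm ?invr_ge0 ?normr_ge0//.
  rewrite -normrZ scalerBr.
  have TE s : `|u|^-1 *: T u s = T (`|u|^-1 *: u) s by rewrite linearZ.
  rewrite !TE; apply: Ut; apply: subset_closure; exists (`|u|^-1 *: u) => //.
  by rewrite /unit_ball /= normrZ normfV normr_id mulVf// gt_eqF.
- move=> u; change (F u t0 = S u).
  by rewrite FE phit0 scale1r addrC subrK.
Qed.

(** The index set, the vectors z_k and the operators S_k come from the property
    of (X, Y) applied to the operators u |-> (T_k u)(t0), where t0 is a point at
    which the sum has norm above 1 - eta; each T_k is then modified near t0,
    with a neighbourhood depending on k. *)
Lemma contraction_AHSP_C0 (Q : set nat -> (nat -> Y) -> Prop)
    (Q' : set nat -> (nat -> C0 L Y) -> Prop) :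
  hausdorff_space L -> locally_compact [set: L] ->
  bounded_operators X (C0 L Y) = compact_operators X (C0 L Y) ->
  (forall A t (w : nat -> Y) (v : nat -> C0 L Y), A !=set0 ->
     (forall k, A k -> `|v k| <= 1 /\ v k t = w k) -> Q A w -> Q' A v) ->
  contraction_AHSP X Q -> contraction_AHSP X Q'.
Proof.
move=> hL lcL bc QQ' hXY e e0.
(* The bound d < 1 makes A nonempty. *)
have [d [d0 de dh _]] := common_lower_bound (divr_gt0 e0 (ltr0Sn K 1))
  (divr_gt0 (@ltr01 K) (ltr0Sn K 1)) (@ltr01 K).
have d1 : d < 1.
  by apply: le_lt_trans dh _; rewrite ltr_pdivrMr// mul1r ltr1n.
have dde : d + d <= e by rewrite [leRHS]splitr lerD.
have de' : d <= e by apply: le_trans dde; rewrite lerDl ltW.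
have [eta0 eta00 {}hXY] := hXY d d0.
have [eta [eta_gt0 etaeta0 eta1 _]] :=
  common_lower_bound eta00 (@ltr01 K) (@ltr01 K).
exists eta => // T x a cT x1 ca big.
have Tx1 k : `|T k (x k)| <= 1 by rewrite -(x1 k); exact: cT.
have cv := convex_combination_cvg ca Tx1.
set g := limn _ in cv big.
have [t0 gt0] : exists t, 1 - eta < `|g t|.
  apply: contrapT => /forallNP gN.
  suff : `|g| <= 1 - eta by move=> /(lt_le_trans big); rewrite ltxx.
  apply: C0_norm_le => [|t]; first by rewrite subr_ge0.
  by rewrite real_leNgt ?rpredB ?real1 ?normr_real ?gtr0_real//; exact/negP/gN.
pose T' k : {linear X -> Y} := C0_eval t0 \o T k.
have cT' k : contraction (T' k).
  by move=> u; apply: le_trans (cT k u); exact: C0_eval_contraction.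
have big' : 1 - eta0 < `|limn (series (fun k => a k *: T' k (x k)))|.
  have /cvg_lim -> := contraction_series_cvg (C0_eval_contraction t0) cv.
    by apply: le_lt_trans gt0; rewrite lerD2l lerN2.
  exact: norm_hausdorff.
have [A [S [z [massA SzA QA]]]] := hXY T' x a cT' x1 ca big'.
have /choice[S' S'P] : forall k, exists S' : {linear X -> C0 L Y}, A k ->
    [/\ contraction S', forall u, `|S' u - T k u| <= (d + d) * `|u| &
        forall u, S' u t0 = S k u].
  move=> k; have [Ak|nAk] := pselect (A k); last by exists (T k).
  have [cS _ _ ST] := SzA k Ak.
  have cptT : compact_operators X (C0 L Y) (T k).
    by rewrite -bc; exact: contraction_bounded.
  have [S' S'P] := modify_near_point hL lcL cptT (cT k) cS d0 ST.
  by exists S'.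
exists A, S', z; split.
- by move=> n; exact: le_trans (massA n) de'.
- move=> k Ak; have [cS z1 zx ST] := SzA k Ak.
  have [cS' S'T S't0] := S'P k Ak; split=> //; first exact: le_trans zx de'.
  by move=> u; apply: le_trans (S'T u) _; rewrite ler_wpM2r.
- apply: QQ' QA; first exact: massive_nonempty ca d1 massA.
  move=> k Ak; have [_ z1 _ _] := SzA k Ak; have [cS' _ S't0] := S'P k Ak.
  by split; [rewrite -z1; exact: cS'|exact: S't0].
Qed.

(** The functional is f |-> ystar (f t). Its norm is 1 and not less because it
    takes the value 1 on some v_k in the unit ball, A being nonempty. *)
Lemma common_functional_C0 A t (w : nat -> Y) (v : nat -> C0 L Y) : A !=set0 ->
  (forall k, A k -> `|v k| <= 1 /\ v k t = w k) ->
  @common_functional R sk Y A w -> @common_functional R sk (C0 L Y) A v.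
Proof.
move=> [k0 Ak0] vw [ystar uy yw].
exists (ystar \o C0_eval t); last by move=> k Ak; rewrite /= /C0_eval (vw k Ak).2 yw.
have cy : contraction (ystar \o C0_eval t).
  move=> f; apply: le_trans (unit_operator_contraction uy _) _.
  exact: C0_eval_contraction.
split; first exact: contraction_bounded.
apply/eqP; rewrite eq_le; apply/andP; split.
  by apply: operator_norm_le => // f; rewrite mul1r; exact: cy.
have := operator_norm_ge (v k0) (contraction_bounded cy).
rewrite /= /C0_eval (vw k0 Ak0).2 yw// normr1 => /le_trans; apply.
rewrite ler_piMr ?(vw k0 Ak0).1//.
exact: (operator_norm_ge0 (contraction_bounded cy)).
Qed.

End localization.

(** * Alignment, a substitute for a norming functional *)

Section alignment.
Variables (R : realType) (sk : scalar_kind).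
Local Notation K := (scalars R sk).

(** For vectors v_k of the unit ball, this says that the v_k with k in A lie on
    one face of the ball: by the Hahn-Banach theorem it amounts to a norm-one
    functional equal to 1 at each of them. *)
Definition aligned (Y : completeNormedModType K) (A : set nat)
    (v : nat -> Y) :=
  forall (b : nat -> K) n, (forall k, 0 <= b k) -> (forall k, ~ A k -> b k = 0) ->
    \sum_(0 <= k < n) b k <= `|\sum_(0 <= k < n) b k *: v k|.

Lemma aligned_C0 (L : topologicalType) (Y : completeNormedModType K)
    (A : set nat) (t : L) (w : nat -> Y) (v : nat -> C0 L Y) :
  (forall k, A k -> `|v k| <= 1 /\ v k t = w k) ->
  @aligned Y A w -> @aligned (C0 L Y) A v.
Proof.
move=> vw Aw b n b0 bA; apply: le_trans (Aw b n b0 bA) _.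
apply: le_trans (C0_eval_contraction t _); rewrite linear_sum /=.
rewrite (eq_bigr (fun k => C0_eval t (b k *: v k)))// => k _.
rewrite linearZ /=; have [Ak|/bA ->] := pselect (A k); last by rewrite !scale0r.
by rewrite -(vw k Ak).2.
Qed.

End alignment.

(** * Operators on l1 sums *)

Section ell1_operators.
Variables (R : realType) (sk : scalar_kind).
Local Notation K := (scalars R sk).
Variable X : completeNormedModType K.

Lemma ell1_single_subproof k (x : X) :
  (fun j => if j == k then x else 0) \in @ell1_pred R sk X.
Proof.
apply: (@ell1_predP _ _ _ _ `|x|) => n; rewrite /series /=.
under eq_bigr do rewrite (fun_if Num.norm) normr0.
by rewrite -big_mkcond big_nat1_eq; case: ifP.
Qed.

Definition ell1_single k (x : X) : ell1 X := MkEll1 (ell1_single_subproof k x).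

Lemma ell1_singleE k x j : ell1_single k x j = if j == k then x else 0.
Proof. by []. Qed.

Lemma ell1_single_linear k : linear (ell1_single k).
Proof.
move=> a x y; apply: ell1_ext => j.
change (ell1_single k (a *: x + y) j =
  a *: ell1_single k x j + ell1_single k y j).
by rewrite !ell1_singleE; case: ifP => //; rewrite scaler0 addr0.
Qed.

HB.instance Definition _ k := GRing.isLinear.Build K X (ell1 X) *:%R
  (ell1_single k) (ell1_single_linear k).

Lemma ell1_single_contraction k : contraction (ell1_single k).
Proof.
move=> x; apply: ell1_norm_le => n; rewrite /series /=.
under eq_bigr do rewrite (fun_if Num.norm) normr0.
by rewrite -big_mkcond big_nat1_eq; case: ifP.
Qed.

Lemma ell1_coord_sum (f : nat -> ell1 X) n j :
  (\sum_(0 <= k < n) f k) j = \sum_(0 <= k < n) f k j.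
Proof.
elim: n => [|n IHn]; first by rewrite !big_geq.
by rewrite !big_nat_recr//= -IHn.
Qed.

Lemma ell1_sum_single (y : nat -> X) n j :
  (\sum_(0 <= k < n) ell1_single k (y k)) j = if (j < n)%N then y j else 0.
Proof.
rewrite ell1_coord_sum; under eq_bigr do rewrite ell1_singleE eq_sym.
by rewrite -big_mkcond big_nat1_eq.
Qed.

Lemma ell1_single_cvg (x : ell1 X) :
  series (fun k => ell1_single k (x k)) @ \oo --> x.
Proof.
have /cvgrPdist_le xcvg : series (fun k => `|x k|) @ \oo --> `|x|.
  exact: ell1_summable.
apply/cvgrPdist_le => e /xcvg; apply: filterS => n.
rewrite ger0_norm; last by rewrite subr_ge0; exact: ell1_norm_ge.
apply: le_trans; apply: ell1_norm_le => m; set N := maxn m n.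
apply: le_trans (series_nneg (fun k => normr_ge0 _) (leq_maxl m n)) _.
rewrite lerBrDr; apply: le_trans (ell1_norm_ge x N).
rewrite /series /= [leRHS](@big_cat_nat _ _ _ n) ?leq_maxr//=.
rewrite [X in X + _ <= _](@big_cat_nat _ _ _ n) ?leq_maxr//=.
rewrite [X in X + _ + _ <= _]big_nat [X in X + _ + _ <= _]big1; last first.
  move=> k /andP[_ kn].
  change (`|x k - (\sum_(0 <= k < n) ell1_single k (x k)) k| = 0).
  by rewrite ell1_sum_single kn subrr normr0.
rewrite add0r [leLHS]addrC; apply: lerD => //.
rewrite [leLHS]big_nat [leRHS]big_nat.
apply: ler_sum => k /andP[nk _].
change (`|x k - (\sum_(0 <= k < n) ell1_single k (x k)) k| <= `|x k|).
by rewrite ell1_sum_single ltnNge nk subr0.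
Qed.

Lemma ell1_operator (Y : completeNormedModType K) (T : nat -> {linear X -> Y}) :
  (forall k, contraction (T k)) ->
  exists F : {linear ell1 X -> Y},
    forall u : ell1 X, series (fun k => T k (u k)) @ \oo --> F u.
Proof.
move=> cT; pose F (u : ell1 X) := limn (series (fun k => T k (u k))).
have Fcvg (u : ell1 X) : series (fun k => T k (u k)) @ \oo --> F u.
  apply: (@absolutely_cvg _ _ _ _ `|u|) => n.
  by apply: le_trans (ell1_norm_ge u n); apply: ler_sum => k _; exact: cT.
have linF : linear F.
  move=> a u w; apply/cvg_lim; first exact: norm_hausdorff.
  rewrite [X in X @ _ --> _](_ : _ = (fun n => a *: series (fun k => T k (u k)) n
    + series (fun k => T k (w k)) n)).
    by apply: cvgD; [apply: cvgZr|]; exact: Fcvg.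
  apply/funext => n; rewrite /series /= scaler_sumr -big_split /=.
  by apply: eq_bigr => k _; rewrite linearP.
pose F' : {linear ell1 X -> Y} :=
  HB.pack F (GRing.isLinear.Build K (ell1 X) Y *:%R F linF).
by exists F'; exact: Fcvg.
Qed.

Lemma ell1_operator_contraction (Y : completeNormedModType K)
    (T : nat -> {linear X -> Y}) (F : {linear ell1 X -> Y}) :
  (forall u : ell1 X, series (fun k => T k (u k)) @ \oo --> F u) ->
  (forall k, contraction (T k)) -> contraction F.
Proof.
move=> FT cT u; apply: (norm_series_le (FT u)) => n.
by apply: le_trans (ell1_norm_ge u n); apply: ler_sum => k _; exact: cT.
Qed.

Lemma ell1_operator_single (Y : completeNormedModType K)
    (T : nat -> {linear X -> Y}) (F : {linear ell1 X -> Y}) :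
  (forall u : ell1 X, series (fun k => T k (u k)) @ \oo --> F u) ->
  forall k x, F (ell1_single k x) = T k x.
Proof.
move=> FT k x; have /cvg_lim <- := FT (ell1_single k x); last first.
  exact: norm_hausdorff.
apply/cvg_lim; first exact: norm_hausdorff.
apply: cvg_near_cst; near=> n; rewrite /series /=.
under eq_bigr => j _ do rewrite (fun_if (T j)) linear0.
rewrite -big_mkcond big_nat1_eq ifT//=; near: n; exact: nbhs_infty_gt.
Unshelve. all: by end_near. Qed.

(** If a multiple C u dominates w = sum_k b_k z_k coordinatewise, where
    z_k = u_k / |u_k|, then |C u - w| = C - sum_k b_k, because in each
    coordinate w is a smaller positive multiple of u. As S (C u) has norm C and S is a
    contraction, S w cannot have norm less than sum_k b_k. *)
Lemma norm_attaining_aligned (Y : completeNormedModType K)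
    (S : {linear ell1 X -> Y}) (u : ell1 X) (A : set nat) :
  contraction S -> `|u| = 1 -> `|S u| = 1 -> (forall k, A k -> u k != 0) ->
  aligned A (fun k => S (ell1_single k (`|u k|^-1 *: u k))).
Proof.
move=> cS u1 Su1 uA b n b0 bA.
(* w = sum_j c_j u_j e_j, and C bounds all the c_j. *)
pose c j := if (j < n)%N then b j / `|u j| else 0.
pose C := \sum_(0 <= k < n) b k / `|u k|.
have bu0 k : 0 <= b k / `|u k| by rewrite divr_ge0.
have C0 : 0 <= C by apply: sumr_ge0.
have cC j : c j <= C.
  rewrite /c; case: ifP => // jn; rewrite /C (bigD1_seq j)/= ?iota_uniq//.
    by rewrite lerDl sumr_ge0.
  by rewrite mem_index_iota.
have cu j : c j * `|u j| = if (j < n)%N then b j else 0.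
  rewrite /c; case: ifP; rewrite ?mul0r// => _.
  have [Aj|/bA ->] := pselect (A j); last by rewrite !mul0r.
  by rewrite divfK// normr_eq0; exact: uA.
pose w : ell1 X := \sum_(0 <= k < n) ell1_single k (b k *: (`|u k|^-1 *: u k)).
have wE j : w j = c j *: u j.
  by rewrite /w ell1_sum_single /c; case: ifP; rewrite ?scalerA ?scale0r.
have SwE : S w = \sum_(0 <= k < n) b k *: S (ell1_single k (`|u k|^-1 *: u k)).
  rewrite linear_sum; apply: eq_bigr => k _.
  by rewrite [ell1_single k (_ *: (_ *: _))]linearZ linearZ.
have Cuw : `|C *: u - w| <= C - \sum_(0 <= k < n) b k.
  apply: ell1_norm_le => m; set N := maxn m n.
  apply: le_trans (series_nneg (fun k => normr_ge0 _) (leq_maxl m n)) _.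
  have E j : `|(C *: u - w) j| = C * `|u j| - (if (j < n)%N then b j else 0).
    change (`|C *: u j - w j| = C * `|u j| - (if (j < n)%N then b j else 0)).
    by rewrite wE -scalerBl normrZ ger0_norm ?subr_ge0// mulrBl cu.
  rewrite /series /= (eq_bigr _ (fun j _ => E j)) sumrB -mulr_sumr lerB//.
    rewrite -[leRHS]mulr1 ler_wpM2l// -u1; exact: ell1_norm_ge.
  rewrite [leRHS](@big_cat_nat _ _ _ n) ?leq_maxr//= -[leLHS]addr0 lerD//.
    by rewrite !big_nat; apply: ler_sum => j /andP[_ ->].
  by apply: sumr_ge0 => j _; case: ifP.
rewrite -SwE -(lerD2r (C - \sum_(0 <= k < n) b k)) addrC subrK.
apply: le_trans (lerD (lexx _) (le_trans (cS _) Cuw)).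
apply: le_trans (ler_normD _ _).
by rewrite -linearD addrC subrK linearZ normrZ Su1 mulr1 ger0_norm.
Qed.

End ell1_operators.

(** * The Bishop-Phelps-Bollobas property for l1 sums *)

Section BPBp_ell1.
Variables (R : realType) (sk : scalar_kind).
Local Notation K := (scalars R sk).
Variables X Y : completeNormedModType K.

(** The T_k are assembled into F on l1(X) and the convex series into the unit
    vector x0 = (a_k x_k). If S attains its norm at u, with S close to F and u
    close to x0, take S_k the restriction of S to the k-th summand,
    z_k = u_k / |u_k|, and for A the indices with |u_k - a_k x_k| small with
    respect to a_k; the mass outside A is controlled by |u - x0|. *)
Lemma BPBp_contraction_AHSP :
  BPBp (ell1 X) Y -> contraction_AHSP X (@aligned R sk Y).
Proof.
move=> hXY e e0.
have [e1 [e10 e1e e11 _]] := common_lower_bound e0 (@ltr01 K) (@ltr01 K).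
(* An index outside A contributes at least a_k * e1 / 2 to |u - x0| < d, so the
   mass outside A is at most 2 * d / e1 = e1. *)
pose d := e1 * e1 / 2.
have d0 : 0 < d by rewrite divr_gt0 ?mulr_gt0.
have d2 : d + d = e1 * e1 by rewrite /d -splitr.
have dde1 : d + d <= e1 by rewrite d2 ler_piMr// ltW.
have [eta0 eta00 {}hXY] := hXY d d0.
have [eta [eta_gt0 etaeta0 etad eta1]] :=
  common_lower_bound eta00 d0 (@ltr01 K).
exists eta => // T x a cT x1 ca big; have a0 := ca.1.
have axE k : `|a k *: x k| = a k by rewrite normrZ ger0_norm// x1 mulr1.
have xin : (fun k => a k *: x k) \in @ell1_pred R sk X.
  apply: (@ell1_predP _ _ _ _ 1) => n; rewrite /series /= (eq_bigr a)//.
  exact: convex_partial_le1.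
pose x0 : ell1 X := MkEll1 xin.
have x0E k : x0 k = a k *: x k by [].
have x01 : `|x0| = 1.
  rewrite ell1_normE (_ : (fun k => `|x0 k|) = a); last by apply/funext.
  by apply: cvg_lim; [exact: norm_hausdorff|exact: ca.2].
have [F FT] := ell1_operator cT.
have cF := ell1_operator_contraction FT cT.
have Fx0 : F x0 = limn (series (fun k => a k *: T k (x k))).
  have /cvg_lim <- := FT x0; last exact: norm_hausdorff.
  congr (limn _); apply/funext => n; apply: eq_bigr => k _.
  by rewrite x0E linearZ.
rewrite -Fx0 in big.
have [F' [uF' F'F FF']] := nearby_unit_operator cF x01 eta1 big.
have big' : 1 - eta0 < `|F' x0|.
  by apply: lt_le_trans (FF' x0); apply: le_lt_trans big; rewrite lerD2l lerN2.
have [S [u [uS u1 Su1 ux0 SF']]] := hXY F' x0 uF' x01 big'.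
have cS := unit_operator_contraction uS.
have SF w : `|S w - F w| <= e1 * `|w|.
  rewrite -(subrKA (F' w)); apply: le_trans (ler_normD _ _) _.
  apply: (@le_trans _ _ ((d + d) * `|w|)); last by rewrite ler_wpM2r.
  rewrite mulrDl; apply: lerD; last first.
    by apply: le_trans (F'F w) _; rewrite ler_wpM2r.
  have bSF : bounded_operators (ell1 X) Y (S \- F').
    exists 2 => v; apply: le_trans (ler_normB _ _) _.
    rewrite mulr_natl mulr2n lerD//.
    exact: (unit_operator_contraction uF').
  apply: le_trans (operator_norm_ge w bSF) _.
  by rewrite ler_wpM2r// ltW.
pose A : set nat := [set k | `|u k - a k *: x k| *+ 2 < e1 * a k].
have aA k : A k -> 0 < a k.
  move=> Ak; rewrite -(pmulr_rgt0 _ e10); apply: le_lt_trans Ak.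
  by rewrite mulrn_wge0.
have uA k : A k -> u k != 0.
  move=> Ak; apply/eqP => uk0; move: (Ak).
  rewrite /A /= uk0 sub0r normrN axE => /lt_le_trans /(_ (_ : _ <= a k)).
  rewrite ler_piMl// => /(_ isT); rewrite mulr2n gtrDl => /lt_le_trans/(_ (a0 k)).
  by rewrite ltxx.
pose z k := `|u k|^-1 *: u k.
have z1 k : A k -> `|z k| = 1.
  by move=> /uA uk; rewrite /z normrZ normfV normr_id mulVf// normr_eq0.
exists A, (fun k => S \o ell1_single k), z; split.
- move=> n; rewrite -(ler_pM2l e10).
  apply: (@le_trans _ _ (series (fun k => `|(u - x0) k|) n *+ 2)).
    rewrite /mass_outside big_mkcond mulr_sumr /series /= -sumrMnl.
    apply: ler_sum => k _; case: ifPn => [kA|_]; last first.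
      by rewrite mulr0 mulrn_wge0.
    change (e1 * a k <= `|u k - a k *: x k| *+ 2).
    rewrite real_leNgt; first by apply/negP => /mem_set; exact/negP.
      by apply: realM; [exact: gtr0_real|exact: ger0_real].
    by rewrite rpredMn ?normr_real.
  apply: (@le_trans _ _ (d *+ 2)).
    by rewrite lerMn2r/=; apply: le_trans (ell1_norm_ge _ _) (ltW ux0).
  by rewrite mulr2n d2 ler_wpM2l// ltW.
- move=> k Ak; split.
  + by move=> w; apply: le_trans (cS _) _; exact: ell1_single_contraction.
  + exact: z1.
  + apply: le_trans e1e; rewrite -(ler_pM2l (aA k Ak)).
    rewrite -{1}(ger0_norm (a0 k)) -normrZ [leRHS]mulrC.
    apply: le_trans (ltW Ak).
    (* The two terms have norm at most |u_k - a_k x_k|. *)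
    have -> : a k *: (z k - x k) = (a k - `|u k|) *: z k + (u k - a k *: x k).
      rewrite /z scalerBl !scalerA divff ?normr_eq0 ?uA// scale1r addrA subrK.
      by rewrite scalerBr scalerA.
    apply: le_trans (ler_normD _ _) _; rewrite mulr2n lerD2r normrZ z1// mulr1.
    by rewrite distrC -{1}(axE k); exact: ler_dist_dist.
  + move=> w; rewrite -(ell1_operator_single FT); apply: le_trans (SF _) _.
    by apply: ler_pM => //; [exact: ltW|exact: ell1_single_contraction].
- exact: (norm_attaining_aligned cS u1 Su1 uA).
Qed.

(** A unit vector x0 of l1(X) is a convex series with weights |x0_k|. The new
    operator F has components S_k for k in A and those of T elsewhere. Alignment
    makes F preserve the norm of u = sum_(k in A) a_k z_k, whose normalization
    is the new vector; u is close to x0, so its norm is close to 1. *)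
Lemma contraction_AHSP_BPBp :
  contraction_AHSP X (@aligned R sk Y) -> BPBp (ell1 X) Y.
Proof.
move=> hXY e e0.
have e50 : 0 < e / 5%:R by rewrite divr_gt0 ?ltr0n.
have i40 : 0 < 4%:R^-1 :> K by rewrite invr_gt0 ltr0n.
(* |u - x0| <= 2 * d, and normalizing u costs as much again; d <= 1/4 keeps u
   away from 0. *)
have [d [d0 de d4 _]] := common_lower_bound e50 i40 i40.
have d4e : d *+ 4 < e.
  rewrite (@lt_le_trans _ _ (d *+ 5))//; first by rewrite (ltr_pMn2l d0).
  by rewrite -mulr_natr -ler_pdivlMr ?ltr0n.
have [eta eta0 {}hXY] := hXY d d0.
exists eta => // T x0 uT x01 big.
have cT := unit_operator_contraction uT.
have x0_neq0 : x0 != 0 by rewrite -normr_eq0 x01 oner_eq0.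
have [k0 xk0] : exists k, x0 k != 0.
  apply: contrapT => /forallNP x00; move/eqP: x0_neq0; apply.
  by apply: ell1_ext => k; have /negP := x00 k; rewrite negbK => /eqP.
pose normalize (y : X) := `|y|^-1 *: y.
have normalize1 y : y != 0 -> `|normalize y| = 1.
  by move=> y0; rewrite /normalize normrZ normfV normr_id mulVf// normr_eq0.
(* At the zero coordinates of x0 the weight vanishes and any unit vector will
   do. *)
pose x k := if x0 k == 0 then normalize (x0 k0) else normalize (x0 k).
pose a k := `|x0 k|.
have x1 k : `|x k| = 1 by rewrite /x; case: eqVneq => [_|?]; exact: normalize1.
have axE k : a k *: x k = x0 k.
  rewrite /x /a; case: eqVneq => [->|xk]; first by rewrite normr0 scale0r.
  by rewrite /normalize scalerA divff ?normr_eq0// scale1r.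
have a0 k : 0 <= a k by exact: normr_ge0.
have ca : convex_series a by split=> //; rewrite -x01; exact: ell1_summable.
pose T' k : {linear X -> Y} := T \o ell1_single k.
have cT' k : contraction (T' k).
  by move=> w; apply: le_trans (cT _) _; exact: ell1_single_contraction.
have Tcvg (u : ell1 X) : series (fun k => T' k (u k)) @ \oo --> T u.
  have Tu := contraction_series_cvg cT (@ell1_single_cvg _ _ _ u).
  exact: Tu.
have big' : 1 - eta < `|limn (series (fun k => a k *: T' k (x k)))|.
  rewrite (_ : (fun k => _) = (fun k => T' k (x0 k))).
    by have /cvg_lim -> := Tcvg x0; [exact: big|exact: norm_hausdorff].
  by apply/funext => k; rewrite -linearZ axE.
have [A [S [z [massA SzA alA]]]] := hXY T' x a cT' x1 ca big'.
pose S' k : {linear X -> Y} := if k \in A then S k else T' k.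
have S'A k : A k -> S' k = S k by move=> Ak; rewrite /S' mem_set.
have S'nA k : ~ A k -> S' k = T' k by move=> Ak; rewrite /S' memNset.
have cS' k : contraction (S' k).
  have [Ak|Ak] := pselect (A k); last by rewrite S'nA.
  by rewrite S'A//; have [] := SzA k Ak.
have [F FS] := ell1_operator cS'.
have cF := ell1_operator_contraction FS cS'.
pose b k := if k \in A then a k else 0.
have b0 k : 0 <= b k by rewrite /b; case: ifP.
have bA k : A k -> b k = a k by move=> Ak; rewrite /b mem_set.
have bnA k : ~ A k -> b k = 0 by move=> Ak; rewrite /b memNset.
have buE k : `|b k *: z k| = b k.
  have [Ak|/bnA ->] := pselect (A k); last by rewrite scale0r normr0.
  by have [_ z1 _ _] := SzA k Ak; rewrite normrZ ger0_norm// z1 mulr1.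
have uin : (fun k => b k *: z k) \in @ell1_pred R sk X.
  apply: (@ell1_predP _ _ _ _ 1) => n; rewrite /series /= (eq_bigr b)//.
  apply: le_trans (convex_partial_le1 n ca); apply: ler_sum => k _.
  by rewrite /b; case: ifP.
pose u : ell1 X := MkEll1 uin.
have uE k : u k = b k *: z k by [].
have ux0 : `|u - x0| <= d *+ 2.
  apply: ell1_norm_le => n.
  apply: (@le_trans _ _ (series a n * d + mass_outside A a n)).
    rewrite /series /= mulr_suml /mass_outside [X in _ <= _ + X]big_mkcond.
    rewrite -big_split /=.
    apply: ler_sum => k _; change (`|u k - x0 k| <=
      a k * d + (if k \notin A then a k else 0)).
    rewrite uE; have [Ak|Ak] := pselect (A k).
      rewrite bA// -axE -scalerBr normrZ ger0_norm// mem_set// addr0 ler_wpM2l//.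
      by have [] := SzA k Ak.
    rewrite bnA// scale0r sub0r normrN memNset//= lerDr mulr_ge0//.
    exact: ltW.
  by rewrite mulr2n lerD// ler_piMl ?convex_partial_le1// ltW.
pose s := `|u|.
have s_ge : 1 - d *+ 2 <= s.
  rewrite lerBlDr -x01 -lerBlDl; apply: le_trans ux0.
  by rewrite distrC lerB_dist.
have s_le : s <= 1.
  apply: ell1_norm_le => n; rewrite /series /= (eq_bigr b)//.
  apply: le_trans (convex_partial_le1 n ca); apply: ler_sum => k _.
  by rewrite /b; case: ifP.
have s0 : 0 < s.
  apply: lt_le_trans s_ge; rewrite subr_gt0.
  apply: (@lt_le_trans _ _ (d *+ 4)); first by rewrite (ltr_pMn2l d0).
  by rewrite -mulr_natr -ler_pdivlMr ?ltr0n// mul1r.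
have sFu : s <= `|F u|.
  have ulim : series (fun k => `|u k|) @ \oo --> s by exact: ell1_summable.
  apply: (scalars_ler_cvg ulim (cvg_norm (FS u)) (ltW s0)) => // n.
  rewrite series_ge0//= /series /=.
  rewrite (eq_bigr b)// (eq_bigr (fun k => b k *: S k (z k))); first exact: alA.
  move=> k _; rewrite linearZ /=.
  have [Ak|/bnA ->] := pselect (A k); first by rewrite S'A.
  by rewrite !scale0r.
pose u0 := s^-1 *: u.
have u01 : `|u0| = 1.
  by rewrite /u0 normrZ gtr0_norm ?invr_gt0// mulVf// gt_eqF.
have Fu0 : 1 <= `|F u0|.
  by rewrite linearZ normrZ gtr0_norm ?invr_gt0// ler_pdivlMl// mulr1.
exists F, u0; split=> //.
- exact: contraction_unit_operator u01 Fu0.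
- by apply/eqP; rewrite eq_le Fu0 andbT -u01; exact: cF.
- apply: le_lt_trans d4e; rewrite -(subrKA u).
  apply: le_trans (ler_normD _ _) _.
  rewrite (mulrnDr d 2 2); apply: lerD => //.
  have -> : u0 - u = (s^-1 - 1) *: u by rewrite scalerBl scale1r.
  rewrite normrZ ger0_norm ?subr_ge0 ?invf_ge1// mulrBl mulVf ?gt_eqF// mul1r.
  by rewrite lerBlDr -lerBlDl.
- have d_lt_e : d < e.
    by apply: le_lt_trans d4e; rewrite -[leLHS]mulr1n (ler_pMn2l d0).
  apply: le_lt_trans d_lt_e; apply: operator_norm_le => [|w]; first exact: ltW.
  have : series (fun k => S' k (w k) - T' k (w k)) @ \oo --> F w - T w.
    rewrite [X in X @ _](_ : _ = series (fun k => S' k (w k))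
        - series (fun k => T' k (w k))); first exact: cvgB.
    by apply/funext => n; rewrite /series /= sumrB.
  move=> /norm_series_le; apply => n.
  apply: (@le_trans _ _ (d * series (fun k => `|w k|) n)).
    rewrite /series /= mulr_sumr; apply: ler_sum => k _.
    have [Ak|Ak] := pselect (A k); first by rewrite S'A//; have [] := SzA k Ak.
    by rewrite S'nA// subrr normr0 mulr_ge0// ltW.
  by rewrite ler_wpM2l ?ell1_norm_ge// ltW.
Qed.

End BPBp_ell1.

(** * The theorem *)

Theorem theorem2p4 (R : realType) (sk : scalar_kind)
    (X Y : completeNormedModType (scalars R sk)) (L : topologicalType)
    (hausdorff_L : hausdorff_space L)
    (locally_compact_L : locally_compact [set: L]) :
  (generalized_AHSP X Y ->
   bounded_operators X (C0 L Y) = compact_operators X (C0 L Y) ->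
   generalized_AHSP X (C0 L Y)) /\
  (BPBp (ell1 X) Y ->
   bounded_operators X (C0 L Y) = compact_operators X (C0 L Y) ->
   BPBp (ell1 X) (C0 L Y)).
Proof.
split=> hXY bc.
  apply: contraction_AHSP_generalized.
  apply: contraction_AHSP_C0 (AHSP_contraction hXY) => //.
  exact: common_functional_C0.
apply: contraction_AHSP_BPBp.
apply: contraction_AHSP_C0 (BPBp_contraction_AHSP hXY) => //.
by move=> A t w v _; exact: aligned_C0.
Qed.
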